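(* Let $X\subset V\times\Delta$ be the set of pairs (ITM permutation, normalized length vector) on which the $\mathcal R$-induction can be iterated forever without stopping, and let $\mathcal T\colon X\to X$ be the projectivized $\mathcal R$-induction (all defined in the context). Let $\mu$ be a $\mathcal T$-invariant Borel probability measure on $X$ which induces the measure of maximal entropy on the canonical suspension of $(X,\mathcal T)$. Then $\mu$-almost every double rotation of infinite type is uniquely ergodic; that is, for $\mu$-almost every $(v,\lambda)\in X$ such that $v$ is the splitting permutation of a $3$-ITM, the interval translation map $F_{v,\lambda}$ has exactly one invariant Borel probability measure.
   Context: **3-ITMs.** An interval translation map (ITM) is a piecewise translation $T\colon I\to I$ of a half-open interval $I$; it is a $3$-ITM if there are exactly three maximal half-open subintervals on which it is a translation. We consider $3$-ITMs with no gap at the extremal sides (no component of $I\setminus T(I)$ touches an endpoint of $I$). Number the intervals $1,2,3$ from left to right, with lengths $\lambda_1,\lambda_2,\lambda_3$; up to reversing orientation the order of the images is $(3,2,1)$ or $(2,3,1)$ (the irreducible case): the image of the first interval in this list is flush left, that of the last is flush right, and the middle one is placed by a free translation parameter $t$. Such maps are double rotations (circle maps translating one arc by $\alpha$ and the complementary arc by $\beta$) after identifying the endpoints of $I$. **Splitting and ITM permutations.** Suppose that two of the images of such a $3$-ITM overlap. Cut each of the two intervals whose images overlap into the part mapped onto the overlap and the remaining part(s). This gives $5$ intervals in the domain, two of which have the same image and the same length. Label the domain intervals by an alphabet $\mathcal A$ of $4$ letters, the two intervals with the same image getting the same letter. Let $w_0$ be the word of length $5$ of labels of the domain intervals from left to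 right. Let $w_1$ be the word of length $5$ of labels of the image intervals from left to right, where the gap $I\setminus T(I)$ (whose length equals that of the overlap) is written $\underline\alpha$, with $\alpha$ the repeated letter of $w_0$. The pair $v=\binom{w_0}{w_1}$ is the splitting permutation of the $3$-ITM. Examples: $\begin{pmatrix}A&D&B&C&D\\ C&D&B&\underline D&A\end{pmatrix}$ and $\begin{pmatrix}A&B&C&B&D\\ C&B&D&\underline B&A\end{pmatrix}$. In general an ITM permutation is a pair of words $v=\binom{w_0}{w_1}$ of length $5$, where $w_0$ uses all $4$ letters of $\mathcal A$ (one of them, $\alpha$, twice) and $w_1$ contains each letter of $\mathcal A$ once and $\underline\alpha$ once. For $\lambda\in\mathbb R_+^{\mathcal A}$ put $\lambda_{\underline\alpha}=\lambda_\alpha$ and $\lambda(w)=\sum_i\lambda_{w(i)}$; let $w^{(k)}$ be the prefix of $w$ of length $k-1$, and $\sigma(k)$ the position of the letter $w_0(k)$ in $w_1$. The ITM $F_{v,\lambda}$ on $[0,\lambda(w_0))$ is $F_{v,\lambda}(x)=x+\lambda(w_1^{(\sigma(k))})-\lambda(w_0^{(k)})$ for $x\in[\lambda(w_0^{(k)}),\lambda(w_0^{(k+1)}))$. **Right Rauzy step** (for $(v,\lambda)$ with the underlined letter at position $4$ or $5$ of $w_1$). Compare $\lambda_{w_0(5)}$ and $\lambda_{w_1(5)}$; if they are equal, stop. Otherwise the larger is the winner $a=w_\epsilon(5)$, the smaller the loser $b=w_{1-\epsilon}(5)$, $\epsilon\in\{0,1\}$. Let $s$ be the substitution $a\mapsto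 ab$ fixing all other symbols. (i) If $a$ is a non-underlined letter occurring exactly once in each of $w_0$ and $w_1$ (the loser $b$ may be the underlined symbol): $\hat w_\epsilon=w_\epsilon$, $\hat w_{1-\epsilon}=s(w_{1-\epsilon}(1)\cdots w_{1-\epsilon}(4))$. (ii) If $\epsilon=0$, $a$ occurs twice in $w_0$ and $w_1(4)=\underline a$: $\hat w_0=s(w_0(1)\cdots w_0(4))$, $\hat w_1=s(w_1(1)w_1(2)w_1(3))\,\underline b$. (iii) If the winner is the underlined symbol $w_1(5)$, the map reduces to a rotation and the induction stops. In (i), (ii) the new lengths are $\hat\lambda_a=\lambda_a-\lambda_b$ (lengths indexed by the underlying letters), all others unchanged. The left Rauzy step is the mirror image: reverse both words, apply the right step, reverse back. **$\mathcal R$-induction.** Apply the right step if the underlined symbol is in one of the last two positions of $w_1$, and the left step if it is in one of the first two positions. Let $V$ be the finite set of ITM permutations obtained, by finitely many steps of the $\mathcal R$-induction, from splitting permutations of irreducible $3$-ITMs with no gap at the extremal sides (order of the images $(3,2,1)$ or $(2,3,1)$ up to reversing orientation) two of whose images overlap. **Projectivized induction and $X$.** Let $\|\lambda\|=\sum_{\alpha\in\mathcal A}\lambda_\alpha$ and $\Delta=\{\lambda\in\mathbb R_+^{\mathcal A}:\|\lambda\|=1\}$. If the $\mathcal R$-induction sends $(v,\lambda)$ to $(\hat v,\hat\lambda)$, put $\mathcal T(v,\lambda)=(\hat v,\hat\lambda/\|\hat\lambda\|)$. $X$ is the set of $(v,\lambda)\in V\times\Delta$ for which $\mathcal T^n(v,\lambda)$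 is defined for all $n\ge0$ (the induction never stops). **Canonical suspension.** This is the suspension flow over $(X,\mathcal T)$ with roof function $r(v,\lambda)=-\log\|\hat\lambda\|$, where $\hat\lambda$ is the unnormalized new length vector. A $\mathcal T$-invariant probability measure $\mu$ induces on the suspension $\{(x,s):x\in X,\ 0\le s<r(x)\}$ the flow-invariant probability measure $\frac{1}{\int r\,d\mu}\,\mu\otimes ds$. It is of maximal entropy if its metric entropy is the supremum of the metric entropies over all flow-invariant Borel probability measures. *)

(* Defs.v *)
From HB Require Import structures.
From mathcomp Require Import all_boot all_order all_algebra.
From mathcomp Require Import all_classical all_reals all_analysis.

Set Implicit Arguments.
Unset Strict Implicit.
Unset Printing Implicit Defensive.

Import Order.TTheory GRing.Theory Num.Theory.
Import numFieldNormedType.Exports.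

Local Open Scope classical_set_scope.
Local Open Scope ring_scope.

(* The alphabet is 'I_4; [(a, false)] is the letter a and [(a, true)] is the
   underlined letter a. *)
Definition symbol : Type := ('I_4 * bool)%type.
Definition plain (a : 'I_4) : symbol := (a, false).
Definition underlined (a : 'I_4) : symbol := (a, true).
Definition symbol0 : symbol := plain ord0.

(* The pair of words (w_0, w_1). *)
Definition itm_pair : Type := (seq symbol * seq symbol)%type.

HB.instance Definition _ := Choice.on itm_pair.
HB.instance Definition _ := isPointed.Build itm_pair ([::], [::]).
HB.instance Definition _ := @isMeasurable.Build default_measure_display
  itm_pair discrete_measurable discrete_measurable0
  discrete_measurableC discrete_measurableU.

Definition is_itm_perm (v : itm_pair) : bool :=
  [exists alpha : 'I_4,
     perm_eq v.1 (plain alpha :: map plain (enum 'I_4)) &&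
     perm_eq v.2 (underlined alpha :: map plain (enum 'I_4))].

(* Length vectors are tuples because these carry the product sigma-algebra;
   an underlined letter has the length of the letter. *)
Definition positive_lengths (R : realType) (l : 4.-tuple R) : Prop :=
  forall a : 'I_4, 0 < tnth l a.

Definition word_length (R : realType) (l : 4.-tuple R) (w : seq symbol) : R :=
  \sum_(c <- w) tnth l c.1.

(* Positions are counted from 0, so that [take k w] is the prefix preceding
   the position k.  The map is extended by the identity outside of its domain
   [0, lambda(w_0)). *)
Definition itm_map (R : realType) (v : itm_pair) (l : 4.-tuple R) (x : R) : R :=
  x + \sum_(k < size v.1)
        if word_length l (take k v.1) <= x < word_length l (take k.+1 v.1)
        then word_length l (take (index (nth symbol0 v.1 k) v.2) v.2)
             - word_length l (take k v.1)
        else 0.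

(* The intervals are indexed by 0, 1, 2 from left to right; [img3 M i] is the
   left endpoint of the image of the i-th one. *)
Record itm3 (R : realType) := Itm3 { len3 : 'I_3 -> R ; img3 : 'I_3 -> R }.

Definition total3 (R : realType) (M : itm3 R) : R := \sum_(i < 3) len3 M i.

Definition left3 (R : realType) (M : itm3 R) (i : 'I_3) : R :=
  \sum_(j < 3 | (j < i)%N) len3 M j.

Definition map3 (R : realType) (M : itm3 R) (x : R) : R :=
  x + \sum_(i < 3)
        if left3 M i <= x < left3 M i + len3 M i
        then img3 M i - left3 M i else 0.

(* The image of p is flush left, that of r is flush right and q is free. *)
Definition image_order3 (R : realType) (M : itm3 R) (p q r : 'I_3) : Prop :=
  [/\ img3 M p = 0,
      img3 M r = total3 M - len3 M r &
      0 <= img3 M q <= total3 M - len3 M q].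

Definition i0 : 'I_3 := @Ordinal 3 0 isT.
Definition i1 : 'I_3 := @Ordinal 3 1 isT.
Definition i2 : 'I_3 := @Ordinal 3 2 isT.

(* Irreducible 3-ITMs with no gap at the extremal sides.  Reversing the
   orientation preserves the order (3,2,1) and maps (2,3,1) to (3,1,2).  The
   second condition says that the three intervals are maximal. *)
Definition irreducible_itm3 (R : realType) (M : itm3 R) : Prop :=
  [/\ forall i, 0 < len3 M i,
      (img3 M i0 - left3 M i0 != img3 M i1 - left3 M i1) &&
      (img3 M i1 - left3 M i1 != img3 M i2 - left3 M i2) &
      [\/ image_order3 M i2 i1 i0,
          image_order3 M i1 i2 i0 |
          image_order3 M i2 i0 i1]].

(* The overlap of the images of i and j is [lo, hi) when lo < hi. *)
Definition overlap_lo (R : realType) (M : itm3 R) (i j : 'I_3) : R :=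
  Num.max (img3 M i) (img3 M j).

Definition overlap_hi (R : realType) (M : itm3 R) (i j : 'I_3) : R :=
  Num.min (img3 M i + len3 M i) (img3 M j + len3 M j).

(* Endpoints of the three intervals, and of the parts of the intervals i and j
   that are mapped onto the overlap of their images. *)
Definition cut_points (R : realType) (M : itm3 R) (i j : 'I_3) : set R :=
  [set x | x = total3 M \/ exists m, x = left3 M m] `|`
  [set x | exists2 m, m = i \/ m = j &
     x = overlap_lo M i j - img3 M m + left3 M m \/
     x = overlap_hi M i j - img3 M m + left3 M m].

(* The intervals of v in the domain are the ones cut out by the cut points, and
   (v, l) induces the 3-ITM.  Since v has five letters of positive length, there
   are exactly five such intervals.  The images of the plain letters of w_1 cover
   the image of the map, hence the underlined letter sits at the gap. *)
Definition splits (R : realType) (M : itm3 R) (v : itm_pair) (l : 4.-tuple R)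
    : Prop :=
  [/\ is_itm_perm v,
      positive_lengths l,
      exists i j : 'I_3,
        [/\ i != j,
            overlap_lo M i j < overlap_hi M i j &
            [set word_length l (take k v.1) | k in [set k | (k <= 5)%N]] =
              cut_points M i j] &
      forall x, 0 <= x < total3 M -> itm_map v l x = map3 M x].

Definition splitting_perm (R : realType) (v : itm_pair) : Prop :=
  exists (M : itm3 R) (l : 4.-tuple R), irreducible_itm3 M /\ splits M v l.

Definition subst (a b : symbol) (w : seq symbol) : seq symbol :=
  flatten [seq if c == a then [:: a; b] else [:: c] | c <- w].

Definition once_in_both (v : itm_pair) (a : symbol) : bool :=
  [&& ~~ a.2, count_mem a v.1 == 1%N & count_mem a v.2 == 1%N].

Definition new_lengths (R : realType) (l : 4.-tuple R) (a b : symbol)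
    : 4.-tuple R :=
  [tuple if i == a.1 then tnth l a.1 - tnth l b.1 else tnth l i | i < 4].

(* [None] means that the induction stops. *)
Definition right_step (R : realType) (v : itm_pair) (l : 4.-tuple R)
    : option (itm_pair * 4.-tuple R) :=
  let c0 := last symbol0 v.1 in
  let c1 := last symbol0 v.2 in
  if tnth l c1.1 < tnth l c0.1 then
    let a := c0 in let b := c1 in
    if once_in_both v a then
      Some ((v.1, subst a b (take 4 v.2)), new_lengths l a b)
    else if (count_mem a v.1 == 2%N) && (nth symbol0 v.2 3 == underlined a.1) then
      Some ((subst a b (take 4 v.1),
             rcons (subst a b (take 3 v.2)) (underlined b.1)),
            new_lengths l a b)
    else None
  else if tnth l c0.1 < tnth l c1.1 then
    let a := c1 in let b := c0 in
    if once_in_both v a then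
      Some ((subst a b (take 4 v.1), v.2), new_lengths l a b)
    else None
  else None.

Definition mirror (v : itm_pair) : itm_pair := (rev v.1, rev v.2).

Definition left_step (R : realType) (v : itm_pair) (l : 4.-tuple R)
    : option (itm_pair * 4.-tuple R) :=
  omap (fun y => (mirror y.1, y.2)) (right_step (mirror v) l).

Definition induction_step (R : realType) (v : itm_pair) (l : 4.-tuple R)
    : option (itm_pair * 4.-tuple R) :=
  let p := find (fun c : symbol => c.2) v.2 in
  if p \in [:: 3; 4]%N then right_step v l
  else if p \in [:: 0; 1]%N then left_step v l
  else None.

Inductive in_V (R : realType) : itm_pair -> Prop :=
| in_V_splitting v of splitting_perm R v : in_V R v
| in_V_step v (l : 4.-tuple R) v' (l' : 4.-tuple R) of
    in_V R v & positive_lengths l & induction_step v l = Some (v', l') :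
    in_V R v'.

Definition lnorm (R : realType) (l : 4.-tuple R) : R := \sum_(a < 4) tnth l a.

Definition simplex (R : realType) : set (4.-tuple R) :=
  [set l | positive_lengths l /\ lnorm l = 1].

Arguments simplex : clear implicits.

Notation base R := (itm_pair * 4.-tuple R)%type.

Definition proj_step (R : realType) (x : base R) : option (base R) :=
  omap (fun y : base R => (y.1, [tuple tnth y.2 a / lnorm y.2 | a < 4]))
    (induction_step x.1 x.2).

Definition X (R : realType) : set (base R) :=
  [set x | [/\ in_V R x.1, simplex R x.2 &
             forall n, iter n (obind (@proj_step R)) (Some x) <> None]].

Arguments X : clear implicits.

(* Extended by the identity where the induction stops, i.e. outside of X. *)
Definition T (R : realType) (x : base R) : base R := odflt x (proj_step x).

Definition roof (R : realType) (x : base R) : R :=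
  if induction_step x.1 x.2 is Some y then - ln (lnorm y.2) else 0.

Definition T_invariant (R : realType) (mu : probability (base R) R) : Prop :=
  mu (X R) = 1%E /\
  forall A, measurable A -> mu (@T R @^-1` A) = mu A.

(* A finite measurable partition is given by a map xi to 'I_k with measurable
   fibers.  The cells of its n-th refinement under f are indexed by w. *)
Definition cell (Y : Type) (f : Y -> option Y) (k : nat) (xi : Y -> 'I_k)
    (n : nat) (w : {ffun 'I_n -> 'I_k}) : set Y :=
  [set y | forall i : 'I_n,
     exists2 z, iter i (obind f) (Some y) = Some z & xi z = w i].

Definition refined_entropy (R : realType) (d : measure_display)
    (Y : measurableType d) (f : Y -> option Y) (nu : probability Y R)
    (k : nat) (xi : Y -> 'I_k) (n : nat) : R :=
  \sum_(w : {ffun 'I_n -> 'I_k})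
    - (fine (nu (cell f xi w)) * ln (fine (nu (cell f xi w)))).

Definition partition_entropy (R : realType) (d : measure_display)
    (Y : measurableType d) (f : Y -> option Y) (nu : probability Y R)
    (k : nat) (xi : Y -> 'I_k) : R :=
  limn (fun n : nat => refined_entropy f nu xi n / n%:R).

Definition metric_entropy (R : realType) (d : measure_display)
    (Y : measurableType d) (f : Y -> option Y) (nu : probability Y R)
    : \bar R :=
  ereal_sup [set h | exists (k : nat) (xi : Y -> 'I_k),
    (forall i, measurable (xi @^-1` [set i])) /\
    h = (partition_entropy f nu xi)%:E].

Definition suspension (R : realType) : set (base R * R) :=
  [set p | X R p.1 /\ 0 <= p.2 < roof p.1].

Arguments suspension : clear implicits.

Definition birkhoff_roof (R : realType) (n : nat) (x : base R) : R :=
  \sum_(i < n) roof (iter i (@T R) x).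

(* The flow may leave the suspension in finite time, as the Birkhoff sums of the
   roof function are not known to diverge: [None] means that the flow is not
   defined up to time t.  The induction is not invertible, so only times t >= 0
   make sense. *)
Definition flow (R : realType) (t : R) (p : base R * R)
    : option (base R * R) :=
  let reached n :=
    birkhoff_roof n p.1 <= p.2 + t < birkhoff_roof n.+1 p.1 in
  if pselect (exists n, reached n) is left h then
    let n := xchoose h in
    Some (iter n (@T R) p.1, p.2 + t - birkhoff_roof n p.1)
  else None.

(* Taking A to be the full space, invariance implies that the flow is almost
   surely defined for all times. *)
Definition flow_invariant (R : realType) (nu : probability (base R * R)%type R)
    : Prop :=
  nu (suspension R) = 1%E /\
  forall t, 0 <= t -> forall A, measurable A ->
    nu (flow t @^-1` (Some @` A)) = nu A.

Definition flow_entropy (R : realType) (nu : probability (base R * R)%type R)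
    : \bar R :=
  metric_entropy (flow (1 : R)) nu.

Definition maximal_entropy (R : realType)
    (nu : probability (base R * R)%type R) : Prop :=
  flow_invariant nu /\
  flow_entropy nu =
    ereal_sup [set flow_entropy nu' | nu' in @flow_invariant R].

(* nu is the normalization of the restriction of mu (x) ds to the suspension. *)
Definition induces (R : realType) (mu : probability (base R) R)
    (nu : probability (base R * R)%type R) : Prop :=
  mu.-integrable (X R) (fun x => (roof x)%:E) /\
  forall A, measurable A ->
    let c : R := (\int[mu]_(x in X R) roof x)%R in
    nu A = (c^-1%:E * (mu \x lebesgue_measure) (A `&` suspension R))%E.

Definition itm_invariant (R : realType) (v : itm_pair) (l : 4.-tuple R)
    (P : probability R R) : Prop :=
  P `[0, word_length l v.1[%classic = 1%E /\
  forall A, measurable A -> P (itm_map v l @^-1` A) = P A.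

(* Measures are identified when they agree on Borel sets. *)
Definition uniquely_ergodic (R : realType) (v : itm_pair) (l : 4.-tuple R)
    : Prop :=
  exists P : probability R R, itm_invariant v l P /\
    forall Q : probability R R, itm_invariant v l Q ->
      forall A, measurable A -> Q A = P A.

(* Main.v *)
(* The induction presents F as a nested sequence of five towers over shrinking
   intervals; between two levels every new piece has an itinerary through the old
   pieces.  If a block of itineraries visiting all old pieces occurs infinitely
   often, then each new tower spends a definite proportion of its time in the
   highest old tower, so the visit frequencies of a half-line contract to a number
   that does not depend on the tower: all orbits have the same uniform frequencies
   of visits, and these are the distribution function of the only invariant measure.

   Such blocks come from Poincare recurrence for the T-invariant measure mu.  Steps
   of type (ii) occur infinitely often almost surely, since otherwise the relative
   length of the doubled letter would eventually increase strictly; and the initial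
   combinatorics recurs.  A finite computation shows that a recurrent pair of words
   with infinitely many steps of type (ii) is one of 32 pairs up to renaming, and
   that 11 steps of type (ii) starting there form a block visiting all pieces. *)

Require Import Defs.
From HB Require Import structures.
From mathcomp Require Import all_boot all_order all_algebra.
From mathcomp Require Import all_classical all_reals all_analysis.
From mathcomp Require Import measurable_realfun.
From mathcomp Require Import ring lra zify.

Set Implicit Arguments.
Unset Strict Implicit.
Unset Printing Implicit Defensive.

Import Order.TTheory GRing.Theory Num.Theory.
Import numFieldNormedType.Exports.

Local Open Scope classical_set_scope.
Local Open Scope ring_scope.

(** * Towers over the bases of induced maps *)

(** The map need not be injective, so different towers may overlap, and everything is deduced from
    Birkhoff sums along single orbits. Within one tower the floors are disjoint translates of the
    piece, told apart by the time left before the return. Hence the endpoint of a half-line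
    separates two orbits of a piece on at most one floor, and their visit counts differ by at most
    1. This is why half-lines are the test sets: the error in an average is the reciprocal of a
    height, and heights grow without bound. Likewise a short interval is met at most once per tower,
    so points have frequency 0 and the frequencies of half-lines form a continuous function, from
    which the measure is built.

    The finite checks replace the order of two lengths, the only real data that a step consults, by
    one bit. The other inequalities hold coefficient by coefficient in the lengths after the step,
    so words decide them. Eleven is a number of steps of type (ii) after which evaluation finds that
    all itineraries meet all pieces, whatever steps of type (i) come in between. *)

Section BirkhoffSums.
Variables (R : realType) (F : R -> R).

Definition bsum (f : R -> R) (x : R) (n : nat) : R := \sum_(i < n) f (iter i F x).

Lemma bsumD f x m n : bsum f x (m + n) = bsum f x m + bsum f (iter m F x) n.
Proof.
rewrite /bsum big_split_ord /=; congr (_ + _).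
by apply: eq_bigr => i _; rewrite addnC iterD.
Qed.

Lemma bsum_bounds f x n : (forall y, 0 <= f y <= 1) -> 0 <= bsum f x n <= n%:R.
Proof.
move=> f01; rewrite /bsum; elim: n => [|n /andP[IH0 IH1]].
  by rewrite big_ord0 lexx.
rewrite big_ord_recr /= -natr1; have /andP[? ?] := f01 (iter n F x).
by rewrite addr_ge0 //= lerD.
Qed.

End BirkhoffSums.

(* The pieces [cut k, cut k.+1), k < 5, tile the base [cut 0, cut 5) of five
   towers. *)
Record level (R : realType) :=
  Level { cut : nat -> R; shift : nat -> R; height : nat -> nat }.

Section Levels.
Variables (R : realType) (F : R -> R) (J0 : R -> bool).

Definition in_piece (t : level R) (k : nat) (x : R) : bool :=
  cut t k <= x < cut t k.+1.

Definition in_base (t : level R) (x : R) : bool := cut t 0 <= x < cut t 5.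

(** The third clause says that every iterate up to the height translates the piece rigidly. The last
    one bounds the entry time uniformly, which extends estimates on the base to all orbits in
    [J0]. *)
Definition tower (t : level R) : Prop :=
  [/\ forall k, (k < 5)%N -> cut t k < cut t k.+1 /\ (0 < height t k)%N,
      forall k x, (k < 5)%N -> in_piece t k x ->
        [/\ iter (height t k) F x = x + shift t k, in_base t (x + shift t k) &
         forall i, (0 < i < height t k)%N -> ~~ in_base t (iter i F x)],
      forall k x y i, (k < 5)%N -> in_piece t k x -> in_piece t k y ->
        (i <= height t k)%N -> iter i F x - x = iter i F y - y &
      exists H, forall x, J0 x -> exists2 i, (i <= H)%N & in_base t (iter i F x)].

(** One step cuts off so little that a return to the new base takes at most two returns to the old
    one. *)
Definition visits (t t' : level R) (e : seq nat) (k : nat) : Prop :=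
  (exists j, [/\ (j < 5)%N, e = [:: j],
     forall x, in_piece t' k x -> in_piece t j x,
     shift t' k = shift t j & height t' k = height t j]) \/
  (exists j m, [/\ (j < 5)%N && (m < 5)%N, e = [:: j; m],
     forall x, in_piece t' k x ->
       [/\ in_piece t j x, in_piece t m (x + shift t j) &
           ~~ in_base t' (x + shift t j)],
     shift t' k = shift t j + shift t m &
     height t' k = (height t j + height t m)%N]).

(** The fourth clause brings the part cut off back into the new base after one old return; it keeps
    entry times bounded. *)
Definition refines (t t' : level R) (e : nat -> seq nat) : Prop :=
  [/\ forall x, in_base t' x -> in_base t x,
      forall k, (k < 5)%N -> visits t t' (e k) k,
      forall k x, (k < 5)%N -> in_piece t' k x -> in_base t' (x + shift t' k),
      forall x, in_base t x -> ~~ in_base t' x ->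
        exists k, [/\ (k < 5)%N, in_piece t k x & in_base t' (x + shift t k)] &
      forall k, (k < 5)%N -> cut t' k < cut t' k.+1].

Lemma base_piece (t : level R) x : in_base t x -> exists2 k, (k < 5)%N & in_piece t k x.
Proof.
rewrite /in_base /in_piece => /andP[h0 h5].
case: (ltP x (cut t 1)) => h1; first by exists 0%N => //; rewrite h0.
case: (ltP x (cut t 2)) => h2; first by exists 1%N => //; rewrite h1.
case: (ltP x (cut t 3)) => h3; first by exists 2%N => //; rewrite h2.
case: (ltP x (cut t 4)) => h4; first by exists 3%N => //; rewrite h3.
by exists 4%N => //; rewrite h4.
Qed.

Lemma tower_max_height (t : level R) : exists M, forall k, (k < 5)%N -> (height t k <= M)%N.
Proof.
exists (\max_(k < 5) height t k) => k hk.
exact: (leq_bigmax (Ordinal hk)).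
Qed.

Lemma tower_refines t t' e : tower t -> refines t t' e -> tower t'.
Proof.
move=> [t1 t2 t3 [H t4]] [sub vis stay ent inc].
have nin x : ~~ in_base t x -> ~~ in_base t' x by apply: contra; apply: sub.
split.
- move=> k hk; split; first exact: inc.
  case: (vis k hk) => [[j [hj _ _ _ ->]]|[j [m [/andP[hj hm] _ _ _ ->]]]].
    by case: (t1 j hj).
  by rewrite addn_gt0; case: (t1 j hj) => _ ->.
- move=> k x hk xk; have st := stay _ _ hk xk.
  case: (vis k hk) => [[j [hj _ pj sj ej]]|[j [m [/andP[hj hm] _ pj sj ej]]]].
    have [a b c] := t2 _ _ hj (pj _ xk); split=> //; first by rewrite ej sj.
    by move=> i; rewrite ej => hi; apply/nin/c.
  have [xj xm out] := pj _ xk.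
  have [a b c] := t2 _ _ hj xj; have [a' b' c'] := t2 _ _ hm xm.
  split=> //; first by rewrite ej sj addnC iterD a a' addrA.
  move=> i; rewrite ej => hi.
  case: (ltngtP i (height t j)) => hij.
  - by apply/nin/c; rewrite hij andbT; case/andP: hi.
  - have -> : i = ((i - height t j) + height t j)%N by rewrite subnK // ltnW.
    by rewrite iterD a; apply/nin/c'; lia.
  - by rewrite hij a.
- move=> k x y i hk xk yk.
  case: (vis k hk) => [[j [hj _ pj sj ej]]|[j [m [/andP[hj hm] _ pj sj ej]]]].
    by rewrite ej; apply: t3 => //; apply: pj.
  have [xj xm _] := pj _ xk; have [yj ym _] := pj _ yk.
  rewrite ej => hi.
  case: (leqP i (height t j)) => hij; first exact: (t3 j).
  have -> : i = ((i - height t j) + height t j)%N by rewrite subnK // ltnW.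
  have [ax _ _] := t2 _ _ hj xj; have [ay _ _] := t2 _ _ hj yj.
  have le : (i - height t j <= height t m)%N by rewrite leq_subLR.
  have := t3 _ _ _ _ hm xm ym le.
  rewrite !iterD ax ay; lra.
- have [M hM] := tower_max_height t.
  (* Having entered the old base, an orbit needs at most one more old tower. *)
  exists (H + M)%N => x x0; have [i hi ix] := t4 _ x0.
  case: (boolP (in_base t' (iter i F x))) => ix'.
    by exists i => //; rewrite (leq_trans hi) ?leq_addr.
  have [k [hk xk xs]] := ent _ ix ix'.
  have [a b c] := t2 _ _ hk xk.
  exists (height t k + i)%N; first by rewrite addnC leq_add // hM.
  by rewrite iterD a.
Qed.

Variable f : R -> R.

Lemma bsum_refines t t' e (A B : nat -> R) : tower t -> refines t t' e ->
  (forall k x, (k < 5)%N -> in_piece t k x ->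
     A k <= bsum F f x (height t k) <= B k) ->
  forall k x, (k < 5)%N -> in_piece t' k x ->
     \sum_(j <- e k) A j <= bsum F f x (height t' k) <= \sum_(j <- e k) B j.
Proof.
move=> [_ t2 _ _] [_ vis _ _ _] AB k x hk xk.
case: (vis k hk) => [[j [hj -> pj sj ->]]|[j [m [/andP[hj hm] -> pj sj ->]]]].
  by rewrite !big_seq1; apply: AB => //; apply: pj.
have [xj xm _] := pj _ xk.
have [a _ _] := t2 _ _ hj xj.
rewrite !big_cons !big_nil !addr0 bsumD a.
have /andP[? ?] := AB _ _ hj xj; have /andP[? ?] := AB _ _ hm xm.
by rewrite !lerD.
Qed.

Lemma height_refines t t' e k : refines t t' e -> (k < 5)%N ->
  height t' k = (\sum_(j <- e k) height t j)%N /\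
  (0 < size (e k))%N /\ all (fun j => j < 5)%N (e k).
Proof.
move=> [_ vis _ _ _] hk.
case: (vis k hk) => [[j [hj -> pj sj ->]]|[j [m [hjm -> pj sj ->]]]].
  by rewrite big_seq1 /= hj.
by rewrite !big_cons big_nil addn0 /= andbT.
Qed.

(* The time needed to enter the base tells the floors of a tower apart. *)
Lemma floors_disjoint t k x z i j : tower t -> (k < 5)%N ->
  in_piece t k x -> in_piece t k z -> (i < j < height t k)%N ->
  iter i F x != iter j F z.
Proof.
move=> [_ t2 _ _] hk xk zk /andP[ij jh]; apply/eqP => E.
have [az bz _] := t2 _ _ hk zk; have [_ _ cx] := t2 _ _ hk xk.
have := congr1 (iter (height t k - j) F) E.
rewrite -!iterD subnK ?(ltnW jh) // az => E'.
have : (0 < height t k - j + i < height t k)%N.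
  by lia.
by move=> /cx; rewrite E' bz.
Qed.

End Levels.

(** The pieces of level [n] that piece [k] of level [n + N] meets, in order, before its return. *)
Fixpoint itinerary (e : nat -> nat -> seq nat) (n N k : nat) : seq nat :=
  if N is N'.+1 then flatten [seq itinerary e n N' j | j <- e (n + N')%N k]
  else [:: k].

Lemma itineraryS e n N k :
  itinerary e n N.+1 k = flatten [seq itinerary e n N j | j <- e (n + N)%N k].
Proof. by []. Qed.

(** In matrix terms: the product of the [N] incidence matrices, with rows indexed by new pieces, is
    positive with row sums at most [B]. *)
Definition positive_block (e : nat -> nat -> seq nat) (n N B : nat) : Prop :=
  forall k, (k < 5)%N ->
    (forall j, (j < 5)%N -> j \in itinerary e n N k) /\
    (size (itinerary e n N k) <= B)%N.

Lemma big_rem_le (R : numDomainType) (s : seq nat) (j : nat) (f : nat -> R) :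
  j \in s -> (forall i, i \in s -> 0 <= f i) -> f j <= \sum_(i <- s) f i.
Proof.
move=> js f0; rewrite (big_rem j) //= lerDl.
by rewrite big_seq sumr_ge0 // => i /mem_rem; apply: f0.
Qed.

(** * Contraction of tower averages along positive blocks *)

Section Sequence.
Variables (R : realType) (F : R -> R) (J0 : R -> bool).
Variables (lv : nat -> level R) (e : nat -> nat -> seq nat).
Hypothesis tower0 : tower F J0 (lv 0).
Hypothesis ref : forall n, refines (lv n) (lv n.+1) (e n).

Lemma towers n : tower F J0 (lv n).
Proof. by elim: n => // n IH; apply: tower_refines IH (ref n). Qed.

Lemma itinerary_lt5 n N k : (k < 5)%N ->
  all (fun j => j < 5)%N (itinerary e n N k).
Proof.
elim: N k => [|N IH] k hk /=; first by rewrite hk.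
have [_ [_ /allP ok]] := height_refines (ref (n + N)) hk.
apply/allP => j /flattenP [s /mapP [i ik ->]] js.
by move/allP: (IH i (ok _ ik)) => /(_ _ js).
Qed.

Lemma itinerary_height n N k : (k < 5)%N ->
  height (lv (n + N)%N) k = (\sum_(j <- itinerary e n N k) height (lv n) j)%N.
Proof.
elim: N k => [|N IH] k hk /=; first by rewrite addn0 big_seq1.
have [E [_ /allP ok]] := height_refines (ref (n + N)) hk.
rewrite addnS E big_flatten big_map /= big_seq [RHS]big_seq.
by apply: eq_bigr => j /ok hj; apply: IH.
Qed.

Lemma bsum_itinerary f n N (A B : nat -> R) :
  (forall k x, (k < 5)%N -> in_piece (lv n) k x ->
     A k <= bsum F f x (height (lv n) k) <= B k) ->
  forall k x, (k < 5)%N -> in_piece (lv (n + N)%N) k x ->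
    \sum_(j <- itinerary e n N k) A j <= bsum F f x (height (lv (n + N)%N) k)
      <= \sum_(j <- itinerary e n N k) B j.
Proof.
move=> AB; elim: N => [|N IH] k x hk /=.
  by rewrite addn0 !big_seq1; apply: AB.
rewrite addnS !big_flatten !big_map /= => xk.
exact: (bsum_refines (towers (n + N)) (ref (n + N)) IH hk xk).
Qed.

Variables N B : nat.
Hypothesis blocks : forall n0, exists2 n, (n0 <= n)%N & positive_block e n N B.

Lemma height_nondecreasing M n m :
  (forall k, (k < 5)%N -> (M <= height (lv n) k)%N) ->
  forall k, (k < 5)%N -> (M <= height (lv (n + m)%N) k)%N.
Proof.
move=> hM; elim: m => [|m IH] k hk; first by rewrite addn0; apply: hM.
have [E [s0 /allP ok]] := height_refines (ref (n + m)) hk.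
rewrite addnS E; case: (e (n + m)%N k) s0 ok => // j s _ ok.
rewrite big_cons (leq_trans (IH j _)) ?leq_addr //.
by apply: ok; rewrite inE eqxx.
Qed.

(** Over a positive block each new tower contains the old towers 0 and 1, so a lower bound on the
    heights grows by at least one. *)
Lemma height_unbounded M :
  exists n, forall m k, (n <= m)%N -> (k < 5)%N -> (M <= height (lv m) k)%N.
Proof.
elim: M => [|M [n IH]]; first by exists 0%N.
have [n1 nn1 pos] := blocks n.
exists (n1 + N)%N => m k hm hk; rewrite -(subnKC hm).
apply: height_nondecreasing hk => {}k hk.
have [vis _] := pos _ hk.
rewrite itinerary_height // (big_rem 0%N) /= ?vis // (big_rem 1%N) /=; last first.
  move: (vis 1%N isT); set s := itinerary _ _ _ _ => v1.
  by have := perm_mem (perm_to_rem (vis 0%N isT)) 1%N; rewrite v1 inE /=.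
have h0 := IH n1 0%N nn1 isT.
have [t1 _ _ _] := towers n1; have [_ h1] := t1 1%N isT.
lia.
Qed.

Definition rate_bounds (f : R -> R) (n : nat) (c d : R) : Prop :=
  forall k x, (k < 5)%N -> in_piece (lv n) k x ->
    c * (height (lv n) k)%:R <= bsum F f x (height (lv n) k)
      <= d * (height (lv n) k)%:R.

Lemma rate_bounds_later f n m c d :
  rate_bounds f n c d -> rate_bounds f (n + m) c d.
Proof.
move=> b k x hk xk.
have := bsum_itinerary b hk xk.
by rewrite -!mulr_sumr itinerary_height // natr_sum.
Qed.

Lemma rate_bounds01 f n : (forall y, 0 <= f y <= 1) -> rate_bounds f n 0 1.
Proof.
by move=> f01 k x hk xk; rewrite mul0r mul1r; apply: bsum_bounds.
Qed.

Definition small_oscillation (f : R -> R) : Prop :=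
  forall n k x y, (k < 5)%N -> in_piece (lv n) k x -> in_piece (lv n) k y ->
    bsum F f x (height (lv n) k) <= bsum F f y (height (lv n) k) + 1.

Lemma highest_tower n : exists2 K, (K < 5)%N &
  forall k, (k < 5)%N -> (height (lv n) k <= height (lv n) K)%N.
Proof.
pose K : 'I_5 := [arg max_(i > ord0) height (lv n) i].
exists K => // k hk; rewrite /K; case: arg_maxnP => //= i _ hi.
exact: (hi (Ordinal hk)).
Qed.

Lemma piece_left n k : (k < 5)%N -> in_piece (lv n) k (cut (lv n) k).
Proof.
move=> hk; have [t1 _ _ _] := towers n; have [c _] := t1 _ hk.
by rewrite /in_piece lexx.
Qed.

(* Every tower at the end of a positive block spends at least the proportion
   1/B of its height in the highest tower at the beginning, over which the
   average of f is known up to the reciprocal of the height. *)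
Lemma rate_bounds_block f n c d (M : nat) : positive_block e n N B ->
  small_oscillation f -> (0 < M)%N ->
  (forall k, (k < 5)%N -> (M <= height (lv n) k)%N) ->
  c <= d -> rate_bounds f n c d ->
  exists c' d', [/\ c <= c', d' <= d, c' <= d', rate_bounds f (n + N) c' d' &
    d' - c' <= (1 - B%:R^-1) * (d - c) + 2 / (B%:R * M%:R)].
Proof.
move=> pos osc M0 hM cd b.
have [K hK maxK] := highest_tower n.
set h := height (lv n) in hM maxK *.
set y := cut (lv n) K.
have yK : in_piece (lv n) K y by apply: piece_left.
set S := bsum F f y (h K).
have hK0 : 0 < (h K)%:R :> R by rewrite ltr0n (leq_trans M0) // hM.
have B0 : (0 < B)%N.
  have [v s] := pos 0%N isT; apply: leq_trans s.
  by case: (itinerary e n N 0) (v 0%N isT).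
have B0' : 0 < B%:R :> R by rewrite ltr0n.
(* The sums over the highest tower obey both the inherited bounds and the oscillation bound around
   the sample [S]. *)
pose lo := Num.max (c * (h K)%:R) (S - 1).
pose hi := Num.min (d * (h K)%:R) (S + 1).
have /andP[Sc Sd] : c * (h K)%:R <= S <= d * (h K)%:R by apply: b.
have loc : c * (h K)%:R <= lo by rewrite le_max lexx.
have hid : hi <= d * (h K)%:R by rewrite ge_min lexx.
have loS : lo <= S by rewrite ge_max Sc gerBl ler01.
have Shi : S <= hi by rewrite le_min Sd lerDl ler01.
have hilo : hi - lo <= 2.
  have : S - 1 <= lo by rewrite le_max lexx orbT.
  have : hi <= S + 1 by rewrite ge_min lexx orbT.
  lra.
have sK x : in_piece (lv n) K x -> lo <= bsum F f x (h K) <= hi.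
  move=> xK; rewrite ge_max le_min.
  have /andP[-> ->] := b _ _ hK xK; rewrite /= /S.
  by rewrite lerBlDr (osc n K) //= (osc n K).
(* Each bound moves towards the average over the tower [K] by the guaranteed proportion 1/B. *)
pose c' := c + (lo / (h K)%:R - c) / B%:R.
pose d' := d - (d - hi / (h K)%:R) / B%:R.
have cl : 0 <= lo / (h K)%:R - c by rewrite subr_ge0 ler_pdivlMr.
have dl : 0 <= d - hi / (h K)%:R by rewrite subr_ge0 ler_pdivrMr.
have dc : d' - c' = (1 - B%:R^-1) * (d - c) + (hi - lo) / (h K)%:R / B%:R.
  by rewrite /d' /c'; field; rewrite !gt_eqF.
have iB : 0 <= B%:R^-1 :> R by rewrite invr_ge0 ltW.
have iB1 : B%:R^-1 <= 1 :> R by rewrite invf_le1 // ler1n.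
exists c', d'; split.
- by rewrite /c' lerDl mulr_ge0.
- by rewrite /d' lerBlDr lerDl mulr_ge0.
- rewrite -subr_ge0 dc addr_ge0 ?mulr_ge0 ?invr_ge0 ?ler0n ?subr_ge0 //.
  exact: le_trans loS Shi.
(* Only the bounds over [K] are improved; the block then gains the improvement at least once. *)
- have AB k x : (k < 5)%N -> in_piece (lv n) k x ->
      c * (h k)%:R + (k == K)%:R * (lo - c * (h K)%:R) <= bsum F f x (h k) <=
      d * (h k)%:R - (k == K)%:R * (d * (h K)%:R - hi).
    move=> hk xk; case: eqP xk => [->|_] xk; last by rewrite !mul0r addr0 subr0 b.
    by rewrite !mul1r subrKC subKr sK.
  move=> k x hk xk.
  have /andP[] := bsum_itinerary AB hk xk.
  rewrite big_split sumrB /= -!mulr_sumr -natr_sum -itinerary_height //.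
  set E := itinerary _ _ _ _; set H := height _ _; set s := bsum _ _ _ _.
  have [vis szE] := pos _ hk.
  have one (u : R) : 0 <= u -> u <= \sum_(j <- E) (j == K)%:R * u.
    move=> u0.
    have := @big_rem_le _ E K (fun j => (j == K)%:R * u) (vis _ hK).
    by rewrite eqxx mul1r; apply => i _; rewrite mulr_ge0.
  have HB : H%:R <= B%:R * (h K)%:R :> R.
    rewrite -natrM ler_nat /H itinerary_height // -/E.
    apply: (@leq_trans (size E * h K)); last by rewrite leq_mul2r szE orbT.
    rewrite -sum1_size big_distrl /= big_seq [leqRHS]big_seq leq_sum // => j jE.
    rewrite mul1n; apply: maxK.
    by move/allP: (itinerary_lt5 n N hk); apply.
  have scale (u : R) : 0 <= u -> u / (h K)%:R / B%:R * H%:R <= u.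
    move=> u0; rewrite mulrAC ler_pdivrMr // mulrAC ler_pdivrMr //.
    by rewrite -mulrA ler_wpM2l.
  have e1 : (lo / (h K)%:R - c) / B%:R = (lo - c * (h K)%:R) / (h K)%:R / B%:R.
    by field; rewrite !gt_eqF.
  have e2 : (d - hi / (h K)%:R) / B%:R = (d * (h K)%:R - hi) / (h K)%:R / B%:R.
    by field; rewrite !gt_eqF.
  have u1 : 0 <= lo - c * (h K)%:R by rewrite subr_ge0.
  have u2 : 0 <= d * (h K)%:R - hi by rewrite subr_ge0.
  have := one _ u1; have := scale _ u1; have := one _ u2; have := scale _ u2.
  rewrite /c' /d' e1 e2 => p1 p2 p3 p4 p5 p6.
  apply/andP; split.
    by rewrite mulrDl; apply: (le_trans _ p5); rewrite lerD2l; apply: le_trans p4.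
  by rewrite mulrBl; apply: le_trans p6 _; rewrite lerD2l lerN2; apply: le_trans p2.
- rewrite dc lerD2l -mulrA -invfM (mulrC _ B%:R).
  apply: ler_pM.
  - by rewrite subr_ge0 (le_trans loS).
  - by rewrite invr_ge0 mulr_ge0.
  - exact: hilo.
  - have M0' : 0 < M%:R :> R by rewrite ltr0n.
    rewrite lef_pV2 ?posrE ?mulr_gt0 //.
    by rewrite ler_pM2l // ler_nat hM.
Qed.

(** While the width exceeds [eps], a block removes at least eps/B from it and adds an error of at
    most q = eps/(2B), so it drops by at least [q]. *)
Lemma rate_bounds_close f (eps : R) : (forall y, 0 <= f y <= 1) ->
  small_oscillation f -> 0 < eps ->
  exists n c d, [/\ 0 <= c, c <= d, d <= 1, rate_bounds f n c d & d - c <= eps].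
Proof.
move=> f01 osc eps0.
have B0 : (0 < B)%N.
  have [n _ pos] := blocks 0; have [v s] := pos 0%N isT; apply: leq_trans s.
  by case: (itinerary e n N 0) (v 0%N isT).
have B0' : 0 < B%:R :> R by rewrite ltr0n.
pose q := eps / 2 / B%:R.
have q0 : 0 < q by rewrite !divr_gt0.
(* Heights above 4/eps make the error 2/(B M0) at most [q]. *)
have [M0 hM0] : exists M : nat, 4 / eps < M%:R.
  by exists (Num.bound (4 / eps)); rewrite archi_boundP // divr_ge0 // ltW.
have M00 : (0 < M0)%N by rewrite -(ltr0n R) (lt_trans _ hM0) // divr_gt0.
have [n1 hn1] := height_unbounded M0.
have step (j : nat) : exists n c d,
    [/\ 0 <= c, c <= d, d <= 1, rate_bounds f n c d &
      d - c <= Num.max eps (1 - j%:R * q)].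
  elim: j => [|j [n [c [d [c0 cd d1 b w]]]]].
    exists 0%N, 0, 1; split=> //; first exact: rate_bounds01.
    by rewrite mul0r !subr0 le_max lexx orbT.
  have [n' nn' pos] := blocks (maxn n n1).
  have b' : rate_bounds f n' c d.
    by rewrite -(subnKC (leq_trans (leq_maxl _ _) nn')); apply: rate_bounds_later.
  have hM k : (k < 5)%N -> (M0 <= height (lv n') k)%N.
    by apply: hn1; apply: leq_trans nn'; apply: leq_maxr.
  have [c' [d' [cc' dd' cd' b'' w']]] := rate_bounds_block pos osc M00 hM cd b'.
  exists (n' + N)%N, c', d'; split=> //; first exact: le_trans cc'.
    exact: le_trans d1.
  have iB1 : B%:R^-1 <= 1 :> R by rewrite invf_le1 // ler1n.
  have iB0 : 0 < B%:R^-1 :> R by rewrite invr_gt0.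
  have small : 2 / (B%:R * M0%:R) <= q.
    rewrite /q ler_pdivrMr ?mulr_gt0 ?ltr0n //.
    have -> : eps / 2 / B%:R * (B%:R * M0%:R) = eps / 2 * M0%:R.
      by field; rewrite gt_eqF.
    rewrite -ler_pdivrMl ?divr_gt0 //; apply: ltW; apply: le_lt_trans hM0.
    by rewrite le_eqVlt; apply/orP; left; apply/eqP; field; rewrite gt_eqF.
  rewrite -natr1 mulrDl mul1r le_max.
  have qE : q = eps / 2 * B%:R^-1 by [].
  case: (lerP (d - c) eps) => we.
    apply/orP; left; apply: le_trans w' _.
    have : (1 - B%:R^-1) * (d - c) <= (1 - B%:R^-1) * eps.
      by rewrite ler_wpM2l ?subr_ge0.
    have : 0 < eps * B%:R^-1 by rewrite mulr_gt0.
    by move: small; rewrite qE; lra.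
  apply/orP; right; move: w; rewrite le_max leNgt we /= => w.
  have : B%:R^-1 * eps <= B%:R^-1 * (d - c) by rewrite ler_pM2l // ltW.
  move: w' small w; rewrite qE; lra.
have [n [c [d [c0 cd d1 b w]]]] := step (Num.bound q^-1).
exists n, c, d; split=> //; move: w; rewrite le_max => /orP[//|w].
have : q^-1 < (Num.bound q^-1)%:R by rewrite archi_boundP // invr_ge0 ltW.
rewrite -(ltr_pM2r q0) mulVf ?gt_eqF // => ?.
by move: cd eps0; lra.
Qed.
End Sequence.

(** * Uniform frequencies *)

Section Frequencies.
Variables (R : realType) (F : R -> R) (J0 : R -> bool).
Hypothesis stable : forall x, J0 x -> J0 (F x).
Hypothesis nonempty : exists x, J0 x.

(** Uniform convergence of the averages, in a form that adds along orbits; [C] absorbs incomplete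
    towers at both ends. *)
Definition frequency (f : R -> R) (g : R) : Prop :=
  forall eps, 0 < eps -> exists C, forall x n, J0 x ->
    `|bsum F f x n - g * n%:R| <= eps * n%:R + C.

Lemma iter_stable x n : J0 x -> J0 (iter n F x).
Proof. by move=> x0; elim: n => //= n; apply: stable. Qed.

Lemma eq_bsum f f' x n : (forall y, J0 y -> f y = f' y) -> J0 x ->
  bsum F f x n = bsum F f' x n.
Proof. by move=> E x0; apply: eq_bigr => i _; apply/E/iter_stable. Qed.

Lemma eq_frequency f f' g : (forall y, J0 y -> f y = f' y) ->
  frequency f g -> frequency f' g.
Proof.
move=> E fg eps /fg [C hC]; exists C => x n x0.
by rewrite -(eq_bsum n E x0); apply: hC.
Qed.

Lemma frequency_le f f' g g' : (forall y, J0 y -> f y <= f' y) ->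
  frequency f g -> frequency f' g' -> g <= g'.
Proof.
move=> ff' fg fg'; rewrite leNgt; apply/negP => gg'.
have [x x0] := nonempty.
(* One third of the gap for each of the two errors, and one for the constants. *)
pose eps := (g - g') / 3.
have eps0 : 0 < eps by rewrite divr_gt0 // subr_gt0.
have [C hC] := fg _ eps0; have [C' hC'] := fg' _ eps0.
pose n := Num.bound ((`|C| + `|C'|) / eps).
have : (`|C| + `|C'|) / eps < n%:R.
  by rewrite archi_boundP // divr_ge0 ?addr_ge0 // ltW.
rewrite ltr_pdivrMr // => hn.
have le : bsum F f x n <= bsum F f' x n.
  by apply: ler_sum => i _; apply/ff'/iter_stable.
move: (hC x n x0) (hC' x n x0); rewrite !ler_norml => /andP[h1 h2] /andP[h3 h4].
have := ler_norm C; have := ler_norm C'.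
have e3 : 3 * (n%:R * eps) = g * n%:R - g' * n%:R by rewrite /eps; field.
by move: hn; lra.
Qed.

Lemma frequency_unique f g g' : frequency f g -> frequency f g' -> g = g'.
Proof.
move=> h h'; apply/le_anti/andP; split.
  exact: (frequency_le _ h h').
exact: (frequency_le _ h' h).
Qed.

Lemma frequency_ub f g d C : (forall x n, J0 x -> bsum F f x n <= d * n%:R + C) ->
  frequency f g -> g <= d.
Proof.
move=> hd fg; rewrite leNgt; apply/negP => dg.
have [x x0] := nonempty.
pose eps := (g - d) / 2.
have eps0 : 0 < eps by rewrite divr_gt0 // subr_gt0.
have [C' hC'] := fg _ eps0.
pose n := Num.bound ((`|C| + `|C'|) / eps).
have : (`|C| + `|C'|) / eps < n%:R.
  by rewrite archi_boundP // divr_ge0 ?addr_ge0 // ltW.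
rewrite ltr_pdivrMr // => hn.
move: (hC' x n x0) (hd x n x0); rewrite ler_norml => /andP[h1 h2] h3.
have := ler_norm C; have := ler_norm C'.
have e3 : 2 * (n%:R * eps) = g * n%:R - d * n%:R by rewrite /eps; field.
by move: hn; lra.
Qed.

Lemma frequencyD f f' g g' : frequency f g -> frequency f' g' ->
  frequency (fun x => f x + f' x) (g + g').
Proof.
move=> fg fg' eps eps0; have e2 : 0 < eps / 2 by rewrite divr_gt0.
have [C hC] := fg _ e2; have [C' hC'] := fg' _ e2.
exists (C + C') => x n x0; rewrite /bsum big_split /=.
move: (hC x n x0) (hC' x n x0); rewrite /bsum !ler_norml => /andP[? ?] /andP[? ?].
by apply/andP; split; lra.
Qed.

Lemma frequencyN f g : frequency f g -> frequency (fun x => - f x) (- g).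
Proof.
move=> fg eps /fg [C hC]; exists C => x n x0.
by rewrite /bsum sumrN mulNr -opprD normrN; apply: hC.
Qed.

Lemma frequency_cst c : frequency (fun=> c) c.
Proof.
move=> eps eps0; exists 0 => x n _.
by rewrite /bsum sumr_const card_ord [c * _]mulr_natr subrr normr0 addr0 mulr_ge0 // ltW.
Qed.

Lemma frequency_sum m (f : 'I_m -> R -> R) (g : 'I_m -> R) :
  (forall k, frequency (f k) (g k)) ->
  frequency (fun x => \sum_(k < m) f k x) (\sum_(k < m) g k).
Proof.
elim: m f g => [|m IH] f g fg.
  rewrite big_ord0; apply: eq_frequency (frequency_cst 0) => y _.
  by rewrite big_ord0.
rewrite big_ord_recl; apply: eq_frequency (frequencyD (fg ord0) (IH _ _ (fun k => fg (lift ord0 k)))) => y _.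
by rewrite big_ord_recl.
Qed.

(** The two Birkhoff sums differ only by a first and a last term. *)
Lemma frequency_comp f g : (forall y, 0 <= f y <= 1) -> frequency f g ->
  frequency (fun x => f (F x)) g.
Proof.
move=> f01 fg eps eps0; have [C hC] := fg _ eps0; exists (C + 1) => x n x0.
have -> : bsum F (fun x => f (F x)) x n = bsum F f x n + f (iter n F x) - f x.
  have b1 y : bsum F f y 1 = f y by rewrite /bsum big_ord_recl big_ord0 addr0.
  have := bsumD F f x 1 n; rewrite add1n -addn1 bsumD !b1 /=.
  suff -> : bsum F (fun x => f (F x)) x n = bsum F f (F x) n by lra.
  by apply: eq_bigr => i _; rewrite -iterSr.
move: (hC x n x0) (f01 x) (f01 (iter n F x)); rewrite !ler_norml.
by move=> /andP[? ?] /andP[? ?] /andP[? ?]; apply/andP; split; lra.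
Qed.

End Frequencies.

(** * Frequencies of half-lines and of short intervals *)

Section TowerFrequencies.
Variables (R : realType) (F : R -> R) (J0 : R -> bool).
Hypothesis nonempty : exists x, J0 x.
Variables (lv : nat -> level R) (e : nat -> nat -> seq nat).
Hypothesis tower0 : tower F J0 (lv 0).
Hypothesis ref : forall n, refines (lv n) (lv n.+1) (e n).
Variables N B : nat.
Hypothesis blocks : forall n0, exists2 n, (n0 <= n)%N & positive_block e n N B.

(** An orbit segment consists of an entry of length at most [H], complete towers, and an incomplete
    tower of length at most [M]. *)
Lemma rate_bounds_bsum f n c d : (forall y, 0 <= f y <= 1) ->
  0 <= c -> c <= d -> d <= 1 -> rate_bounds F lv f n c d ->
  exists C, forall x m, J0 x ->
    c * m%:R - C <= bsum F f x m <= d * m%:R + C.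
Proof.
move=> f01 c0 cd d1 b.
have [t1 t2 _ [H t4]] := towers tower0 ref n.
have [M hM] := tower_max_height (lv n).
have small x m K : (m <= K)%N -> c * m%:R - K%:R <= bsum F f x m <= d * m%:R + K%:R.
  move=> mK; have /andP[s0 s1] := bsum_bounds F x m f01.
  have m0 : 0 <= m%:R :> R by [].
  have mK' : m%:R <= K%:R :> R by rewrite ler_nat.
  have : c * m%:R <= m%:R by rewrite ler_piMl // (le_trans cd).
  have : 0 <= d * m%:R by rewrite mulr_ge0 // (le_trans c0).
  by move=> ? ?; apply/andP; split; lra.
have base m x : in_base (lv n) x ->
    c * m%:R - M%:R <= bsum F f x m <= d * m%:R + M%:R.
  elim/ltn_ind: m x => m IH x xb.
  case: (leqP m M) => mM; first exact: small.
  have [k hk xk] := base_piece xb.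
  have hm : (height (lv n) k <= m)%N by rewrite (leq_trans (hM _ hk)) // ltnW.
  have [a bb _] := t2 _ _ hk xk.
  have [_ h0] := t1 _ hk.
  have /andP[p1 p2] := b _ _ hk xk.
  have lt : (m - height (lv n) k < m)%N by lia.
  have := IH _ lt _ bb.
  have E : bsum F f x m = bsum F f x (height (lv n) k) +
      bsum F f (x + shift (lv n) k) (m - height (lv n) k).
    by rewrite -{1}(subnKC hm) bsumD a.
  rewrite E natrB // => /andP[? ?].
  by apply/andP; split; lra.
exists (M%:R + H%:R) => x m x0.
have [i iH xb] := t4 _ x0.
case: (leqP m i) => im.
  have /andP[? ?] := small x m _ (leq_trans im iH).
  have : 0 <= M%:R :> R by [].
  by move=> ?; apply/andP; split; lra.
have /andP[p1 p2] := base (m - i)%N _ xb.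
have /andP[q1 q2] := small x i _ iH.
rewrite natrB ?(ltnW im) // in p1 p2.
have -> : bsum F f x m = bsum F f x i + bsum F f (iter i F x) (m - i).
  by rewrite -{1}(subnKC (ltnW im)) bsumD.
have ? : i%:R <= H%:R :> R by rewrite ler_nat.
by apply/andP; split; lra.
Qed.

(** The frequency is the supremum of the lower rates: each [c] from [rate_bounds_close] is such a
    rate and each [d] bounds them all. *)
Lemma frequency_exists f : (forall y, 0 <= f y <= 1) ->
  small_oscillation F lv f -> exists g, frequency F J0 f g.
Proof.
move=> f01 osc.
pose A : set R := [set c | exists C, forall x m, J0 x -> c * m%:R - C <= bsum F f x m].
have A0 : A 0.
  exists 0 => x m _; rewrite mul0r subr0.
  by have /andP[] := bsum_bounds F x m f01.
have [x0 J0x0] := nonempty.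
have ub d C : (forall x m, J0 x -> bsum F f x m <= d * m%:R + C) -> ubound A d.
  move=> hd c [C' hc]; rewrite leNgt; apply/negP => dc.
  pose m := Num.bound ((`|C| + `|C'|) / (c - d)).
  have : (`|C| + `|C'|) / (c - d) < m%:R.
    by rewrite archi_boundP // divr_ge0 // ?subr_ge0 ?ltW // addr_ge0.
  rewrite ltr_pdivrMr ?subr_gt0 // => hm.
  have := hd _ m J0x0; have := hc _ m J0x0.
  have := ler_norm C; have := ler_norm C'.
  by move: hm; lra.
have hsA d : ubound A d -> has_sup A by move=> h; split; [exists 0|exists d].
exists (sup A) => eps eps0.
have [n [c [d [c0 cd d1 b w]]]] := rate_bounds_close tower0 ref blocks f01 osc eps0.
have [C hC] := rate_bounds_bsum f01 c0 cd d1 b.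
have Ac : A c by exists C => x m /hC => /(_ m) /andP[].
have Ad : ubound A d by apply: (ub d C) => x m /hC => /(_ m) /andP[].
have cA : c <= sup A by apply: sup_upper_bound => //; apply: hsA Ad.
have dA : sup A <= d by apply: ge_sup => //; exists c.
exists C => x m /hC => /(_ m) /andP[h1 h2].
have m0 : 0 <= m%:R :> R by [].
rewrite ler_norml; apply/andP; split.
  have : (sup A - c) * m%:R <= eps * m%:R by rewrite ler_wpM2r //; lra.
  by lra.
have : (d - sup A) * m%:R <= eps * m%:R by rewrite ler_wpM2r //; lra.
by lra.
Qed.

Definition downset (A : set R) : Prop := forall x y, A y -> x <= y -> A x.

Lemma indic01 (A : set R) y : 0 <= (\1_A y : R) <= 1.
Proof. by rewrite indicE; case: (_ \in _); rewrite /= ?lexx ?ler01. Qed.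

(** For x < y the sum at x exceeds that at y only through times when the end of A separates the two
    iterates. Two such times would make two floors of one tower intersect. *)
Lemma downset_small_oscillation A : downset A -> small_oscillation F lv \1_A.
Proof.
move=> dA n k x y hk xk yk.
have tn := towers tower0 ref n.
have [_ _ t3 _] := tn.
set h := height _ _ in t3 *.
have [yx|xy] := lerP y x.
  apply: ler_wpDr => //; apply: ler_sum => i _; rewrite !indicE ler_nat.
  have := t3 k x y i hk xk yk (ltnW (ltn_ord i)) => E.
  case: (boolP (iter i F x \in A)) => // /set_mem Ax.
  by rewrite mem_set //; apply: dA Ax _; lra.
pose cr i : bool := (iter i F x \in A) && (iter i F y \notin A).
have nocr i : ~~ cr i -> \1_A (iter i F x) <= \1_A (iter i F y) :> R.
  rewrite negb_and negbK !indicE ler_nat => /orP[/negbTE->//|->].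
  exact: leq_b1.
case: (pickP (fun i : 'I_h => cr i)) => [i ci|no]; last first.
  by apply: ler_wpDr => //; apply: ler_sum => i _; apply/nocr; rewrite no.
rewrite /bsum (bigD1 i) //= [X in _ <= X + _](bigD1 i) //=.
suff : \sum_(j < h | j != i) \1_A (iter j F x) <=
       \sum_(j < h | j != i) \1_A (iter j F y) :> R.
  have /andP[_ ?] := indic01 A (iter i F x).
  by have /andP[? _] := indic01 A (iter i F y); lra.
apply: ler_sum => j ji; apply: nocr; apply/negP => cj.
wlog ij : i j ci cj ji / (i < j)%N.
  move=> W; case: (ltngtP i j) => [ij|ij|/val_inj E].
  - exact: (W i j).
  - by apply: (W j i) => //; rewrite eq_sym.
  - by rewrite E eqxx in ji.
have jh := ltn_ord j; have ih := ltn_ord i.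
case/andP: ci => /set_mem xi /negP yi; case/andP: cj => /set_mem xj /negP yj.
have Ei := t3 k x y i hk xk yk (ltnW ih).
have Ej := t3 k x y j hk xk yk (ltnW jh).
have ltij : iter i F x < iter j F y.
  by rewrite ltNge; apply/negP => le; apply/yj/mem_set/(dA _ _ xi).
have ltji : iter j F x < iter i F y.
  by rewrite ltNge; apply/negP => le; apply/yi/mem_set/(dA _ _ xj).
(* The two floors differ by less than y - x, so a point of the piece between x and y has on the
   lower floor the image that x has on the higher one. *)
have zin d : 0 <= d -> d < y - x -> in_piece (lv n) k (x + d).
  by move: xk yk; rewrite /in_piece => /andP[? ?] /andP[? ?] ? ?; apply/andP; split; lra.
have ijh : (i < j < h)%N by rewrite ij jh.
have [le|lt] := lerP (iter i F x) (iter j F x).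
  have zk : in_piece (lv n) k (x + (iter j F x - iter i F x)) by apply: zin; lra.
  have E := t3 k x _ i hk xk zk (ltnW ih).
  by have /eqP := floors_disjoint tn hk zk xk ijh; apply; lra.
have zk : in_piece (lv n) k (x + (iter i F x - iter j F x)) by apply: zin; lra.
have E := t3 k x _ j hk xk zk (ltnW jh).
by have /eqP := floors_disjoint tn hk xk zk ijh; apply; lra.
Qed.

Lemma downset_frequency A : downset A -> exists g, frequency F J0 \1_A g.
Proof.
by move=> dA; apply: frequency_exists (indic01 A) (downset_small_oscillation dA).
Qed.

(** A return that meets the interval at most once and lasts at least [M] > 1/eps steps gives a
    frequency of at most 1/M. *)
Lemma short_interval_frequency (eps : R) : 0 < eps ->
  exists2 d : R, 0 < d & forall a b g, a <= b -> b < a + d ->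
    frequency F J0 \1_[set x | a <= x <= b] g -> g <= eps.
Proof.
move=> eps0.
have [M hM] : exists M : nat, 1 / eps < M%:R.
  by exists (Num.bound (1 / eps)); rewrite archi_boundP // divr_ge0 // ltW.
have [n /(_ n _ (leqnn n)) hn] := height_unbounded tower0 ref blocks M.
have tn := towers tower0 ref n; have [t1 _ t3 _] := tn.
(* Half a piece: for |s| below it, one of x + s and x - s stays in the piece of x, and two visits at
   distance s would make floors intersect. *)
pose w k := (cut (lv n) k.+1 - cut (lv n) k) / 2.
have w0 k : (k < 5)%N -> 0 < w k.
  by move=> hk; have [? _] := t1 _ hk; rewrite divr_gt0 // subr_gt0.
pose d := Num.min (Num.min (w 0%N) (w 1%N)) (Num.min (w 2%N) (Num.min (w 3%N) (w 4%N))).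
have dw k : (k < 5)%N -> d <= w k.
  by case: k => [|[|[|[|[|k]]]]] //= _; rewrite /d !ge_min lexx ?orbT.
exists d; first by rewrite !lt_min !w0.
move=> a b g ab bd fg.
have M0 : 0 < M%:R :> R by apply: lt_trans hM; rewrite divr_gt0.
have M1 : 1 <= M%:R :> R by rewrite ler1n -(ltr0n R).
set I : set R := [set x | _] in fg *.
have b1 k x : (k < 5)%N -> in_piece (lv n) k x -> bsum F \1_I x (height (lv n) k) <= 1.
  move=> hk xk; set h := height _ _ in t3 *.
  case: (pickP (fun i : 'I_h => iter i F x \in I)) => [i iI|no]; last first.
    by rewrite /bsum big1 // => i _; rewrite indicE no.
  rewrite /bsum (bigD1 i) //= big1 ?addr0; first by have /andP[] := indic01 I (iter i F x).
  move=> j ji; rewrite indicE; case: (boolP (_ \in I)) => // jI; exfalso.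
  wlog ij : i j iI jI ji / (i < j)%N.
    move=> W; case: (ltngtP i j) => [ij|ij|/val_inj E].
    - exact: (W i j).
    - by apply: (W j i) => //; rewrite eq_sym.
    - by rewrite E eqxx in ji.
  have jh := ltn_ord j; have ih := ltn_ord i.
  move: iI jI => /set_mem /= /andP[i1 i2] /set_mem /= /andP[j1 j2].
  have dk := dw _ hk.
  pose s := iter j F x - iter i F x.
  have : in_piece (lv n) k (x + s) || in_piece (lv n) k (x - s).
    move: xk; rewrite /in_piece /s => /andP[xk1 xk2]; move: dk; rewrite /w => dk.
    have [c1|c1] := lerP (cut (lv n) k) (x + (iter j F x - iter i F x));
    have [c2|c2] := lerP (cut (lv n) k) (x - (iter j F x - iter i F x));
    have [c3|c3] := ltrP (x + (iter j F x - iter i F x)) (cut (lv n) k.+1);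
    have [c4|c4] := ltrP (x - (iter j F x - iter i F x)) (cut (lv n) k.+1) => //=;
    exfalso; lra.
  have ijh : (i < j < h)%N by rewrite ij jh.
  case/orP => zk.
    have E := t3 k x _ i hk xk zk (ltnW ih).
    by have /eqP := floors_disjoint tn hk zk xk ijh; apply; move: E; rewrite /s; lra.
  have E := t3 k x _ j hk xk zk (ltnW jh).
  by have /eqP := floors_disjoint tn hk xk zk ijh; apply; move: E; rewrite /s; lra.
have iM : 0 <= M%:R^-1 :> R by rewrite invr_ge0.
have iM1 : M%:R^-1 <= 1 :> R by rewrite invf_le1.
have rb : rate_bounds F lv \1_I n 0 M%:R^-1.
  move=> k x hk xk; rewrite mul0r; have /andP[-> _] := bsum_bounds F x (height (lv n) k) (indic01 I).
  apply: le_trans (b1 _ _ hk xk) _; rewrite mulrC ler_pdivlMr // mul1r ler_nat.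
  exact: hn.
have [C hC] := rate_bounds_bsum (indic01 I) (lexx 0) iM iM1 rb.
have : g <= M%:R^-1.
  apply: (frequency_ub _ (C := C) _ fg) => // x m /hC => /(_ m) /andP[_ ->//].
move=> /le_trans; apply; rewrite -div1r ler_pdivrMr // mulrC -ler_pdivrMr //.
exact: ltW.
Qed.

End TowerFrequencies.

(** * Unique ergodicity *)

Section ProbabilityFromCdf.
Variables (R : realType) (G : R -> R).
Hypothesis G_nd : {homo G : x y / x <= y}.
Hypothesis G_rc : right_continuous G.
Hypothesis G_Ny : G @ -oo --> (0 : R).
Hypothesis G_y : G @ +oo --> (1 : R).

#[local] HB.instance Definition _ := isCumulative.Build R _ R G G_nd G_rc.
#[local] HB.instance Definition _ := isCumulativeBounded.Build R 0 1 G G_Ny G_y.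

Let idTR : measurableTypeR R -> R := idfun.
#[local] HB.instance Definition _ :=
  @isMeasurableFun.Build _ _ _ _ idTR (@measurable_id _ _ setT).

(** The law of the identity carries the Lebesgue-Stieltjes measure of [G] over to [R]. *)
Lemma cdf_probability :
  exists P : probability R R, forall t, P `]-oo, t]%classic = (G t)%:E.
Proof.
exists (distribution (lebesgue_stieltjes_measure G) idTR) => t.
exact: (cdf_lebesgue_stieltjes_id G t).
Qed.

End ProbabilityFromCdf.

(** Open rays are increasing unions of closed ones; they are stable under intersection and generate
    the Borel sets. *)
Lemma probability_eq_rays (R : realType) (P Q : probability R R) :
  (forall t, P `]-oo, t]%classic = Q `]-oo, t]%classic) ->
  forall A, measurable A -> P A = Q A.
Proof.
move=> PQ.
have PQo t : P `]-oo, t[%classic = Q `]-oo, t[%classic.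
  pose S n : set R := `]-oo, t - n.+1%:R^-1]%classic.
  have US : \bigcup_n S n = `]-oo, t[%classic.
    rewrite predeqE => x; rewrite /S /= in_itv /=; split.
      move=> [n _] /=; rewrite in_itv /= => xt; apply: le_lt_trans xt _.
      by rewrite ltrBlDr ltrDl invr_gt0.
    by move=> /ltr_add_invr [k xk]; exists k => //=; rewrite in_itv /= lerBrDr ltW.
  have cv (m : probability R R) : (m \o S) n @[n --> \oo] --> m `]-oo, t[%classic.
    rewrite -US; apply: nondecreasing_cvg_mu.
    - by move=> n; apply: measurable_itv.
    - by apply: bigcupT_measurable => n; apply: measurable_itv.
    move=> i j ij; apply/subsetPset/subset_itv => //.
    by rewrite leBSide /= lerD2l lerN2 lef_pV2 ?posrE // ler_nat.
  have E : P \o S = Q \o S by apply/funext => n; apply: PQ.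
  by have := cv P; rewrite E => /cvg_unique; apply; [exact: ereal_hausdorff|exact: cv].
apply: (measure_unique (@RGenInftyO.G R) (fun n => `]-oo, n%:R[%classic)).
- exact: RGenInftyO.measurableE.
- move=> _ _ [x ->] [y ->]; exists (Num.min x y).
  by rewrite predeqE => z /=; rewrite !in_itv /= lt_min; split => /andP.
- by move=> n; exists n%:R.
- rewrite predeqE => x; split => // _; exists (Num.bound `|x|) => //=.
  by rewrite in_itv /= (le_lt_trans (ler_norm x)) // archi_boundP.
- by move=> _ [x ->]; apply: PQo.
- by move=> k; rewrite (le_lt_trans (probability_le1 _ _)) ?ltry.
Qed.

Lemma invariant_rays (R : realType) (F : {mfun R >-> R}) (P : probability R R) :
  (forall t, P (F @^-1` `]-oo, t]) = P `]-oo, t]%classic) ->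
  forall A, measurable A -> P (F @^-1` A) = P A.
Proof. exact: (probability_eq_rays (P := distribution P F)). Qed.

Section Pieces.
Variables (R : realType) (t : level R).
Hypothesis inc : forall k, (k < 5)%N -> cut t k < cut t k.+1.

Lemma cut_le i j : (i <= j)%N -> (j <= 5)%N -> cut t i <= cut t j.
Proof.
elim: j => [|j IH]; first by rewrite leqn0 => /eqP->.
rewrite leq_eqVlt => /orP[/eqP<- //|ij] hj.
by rewrite (le_trans (IH ij (ltnW hj))) // ltW // inc.
Qed.

Lemma piece_unique k j x : (k < 5)%N -> (j < 5)%N ->
  in_piece t k x -> in_piece t j x -> k = j.
Proof.
move=> hk hj xk xj.
wlog kj : k j hk hj xk xj / (k < j)%N.
  by move=> W; case: (ltngtP k j) => // kj; [apply: W|apply/esym/W].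
have := cut_le kj (ltnW hj).
by move: xk xj; rewrite /in_piece => ? ? ?; exfalso; lra.
Qed.

Lemma piece_base k x : (k < 5)%N -> in_piece t k x -> in_base t x.
Proof.
move=> hk /andP[h1 h2]; rewrite /in_base (le_trans (cut_le _ _) h1) // ?(ltnW hk) //=.
by rewrite (lt_le_trans h2) // cut_le.
Qed.

End Pieces.

Section UniqueErgodicity.
Variables (R : realType) (F : R -> R) (L : R).
Let J0 (x : R) : bool := 0 <= x < L.
Let J := [set` `[0, L[] : set R.
Hypothesis mF : measurable_fun setT F.
Hypothesis stable : forall x, J0 x -> J0 (F x).

Definition invariant (P : probability R R) : Prop :=
  P J = 1%E /\ forall A, measurable A -> P (F @^-1` A) = P A.

Lemma measurable_preimageF A : measurable A -> measurable (F @^-1` A).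
Proof. by move=> mA; rewrite -[X in measurable X]setTI; apply: mF. Qed.

Lemma measurable_iter n : measurable_fun setT (iter n F).
Proof. by elim: n => [|n IH]; [exact: measurable_id|exact: measurableT_comp]. Qed.

Lemma setI_full (P : probability R R) A : P J = 1%E -> measurable A ->
  P (A `&` J) = P A.
Proof.
move=> PJ mA.
have mJ : measurable J by apply: measurable_itv.
have PJC : P (~` J) = 0%E by rewrite probability_setC // PJ subee.
have mI : measurable (A `&` J) by apply: measurableI.
have mIC : measurable (A `&` ~` J) by apply: measurableI => //; apply: measurableC.
have d0 : (A `&` J) `&` (A `&` ~` J) = set0 by rewrite setIACA setICr setI0.
have -> : P A = (P (A `&` J) + P (A `&` ~` J))%E.
  by rewrite -measureU // -setIUr setUv setIT.
have -> : P (A `&` ~` J) = 0%E.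
  have mJC := measurableC mJ.
  apply/eqP; rewrite -measure_le0 -PJC.
  by apply: le_measure; rewrite ?inE //; apply: subIsetr.
by rewrite adde0.
Qed.

Lemma invariant_iter P A n : invariant P -> measurable A ->
  P (iter n F @^-1` A) = P A.
Proof.
move=> [_ inv] mA; elim: n => // n IH.
rewrite -IH -[RHS]inv; last by rewrite -[X in measurable X]setTI; apply: measurable_iter.
by congr (P _); rewrite predeqE => x /=; rewrite -iterSr.
Qed.

(* By invariance the n-th Birkhoff sum of the indicator of A has integral n P(A). *)
Lemma invariant_le_frequency P A g : invariant P -> measurable A ->
  frequency F J0 \1_A g -> (P A <= g%:E)%E.
Proof.
move=> inv mA fg; have [PJ _] := inv.
have mJ : measurable J by apply: measurable_itv.
pose p := fine (P A).
have pE : P A = p%:E by rewrite fineK // fin_num_measure.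
rewrite pE lee_fin; apply/ler_addgt0Pr => eps eps0.
have e2 : 0 < eps / 2 by rewrite divr_gt0.
have [C hC] := fg _ e2.
have bound n : p * n%:R <= (g + eps / 2) * n%:R + C.
  have mi (i : 'I_n) : measurable (iter i F @^-1` A).
    by rewrite -[X in measurable X]setTI; apply: measurable_iter.
  have : (\int[P]_(x in J) (\sum_(i < n) (\1_(iter i F @^-1` A) x)%:E) = (p * n%:R)%:E)%E.
    rewrite ge0_integral_sum //; last first.
      by move=> i; apply/measurable_EFinP; apply: measurable_indic.
    have E (i : 'I_n) : (\int[P]_(x in J) (\1_(iter i F @^-1` A) x)%:E = p%:E)%E.
      rewrite integral_indic // -pE -(invariant_iter i inv mA).
      exact: setI_full.
    under eq_bigr => i _ do rewrite E.
    by rewrite sumEFin sumr_const card_ord mulr_natr.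
  rewrite -lee_fin => <-.
  apply: (@le_trans _ _ (\int[P]_(x in J) cst ((g + eps / 2) * n%:R + C)%:E x)%E); last first.
    by rewrite integral_cst // [X in (_ * X)%E](_ : _ = 1%E) ?mule1.
  apply: ge0_le_integral => //.
  - by move=> x _; apply: sume_ge0 => i _; rewrite lee_fin.
  - apply: emeasurable_sum => i; apply/measurable_EFinP; exact: measurable_indic.
  - move=> x; rewrite /J /= in_itv /= => x0; rewrite sumEFin lee_fin.
    have := hC x n x0; rewrite ler_norml /bsum => /andP[_ ?].
    by under eq_bigr => i _ do rewrite (_ : \1_(iter i F @^-1` A) x = \1_A (iter i F x)) //; lra.
rewrite leNgt; apply/negP => lt.
pose n := Num.bound (`|C| / (eps / 2)).
have : `|C| / (eps / 2) < n%:R by rewrite archi_boundP // divr_ge0 // ltW.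
rewrite ltr_pdivrMr // => hn.
have := bound n; have := ler_norm C.
have : (g + eps) * n%:R <= p * n%:R by rewrite ler_wpM2r // ltW.
by move: hn; lra.
Qed.

(** The upper bound for the complement of A is the lower bound for A. *)
Lemma invariant_eq_frequency P A g : invariant P -> measurable A ->
  frequency F J0 \1_A g -> P A = g%:E.
Proof.
move=> inv mA fg; apply/eqP; rewrite eq_le (invariant_le_frequency inv mA fg) /=.
have fC : frequency F J0 \1_(~` A) (1 - g).
  apply: eq_frequency (frequencyD (frequency_cst F J0 1) (frequencyN fg)) => // x _.
  by rewrite !indicE in_setC; case: (x \in A); rewrite /= ?subrr ?subr0.
have := invariant_le_frequency inv (measurableC mA) fC.
rewrite probability_setC //.
have -> : P A = (fine (P A))%:E by rewrite fineK // fin_num_measure.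
by rewrite -EFinB !lee_fin lerD2l lerN2.
Qed.

Hypothesis L0 : 0 < L.
Variables (lv : nat -> level R) (e : nat -> nat -> seq nat) (N B : nat).
Hypothesis tower0 : tower F J0 (lv 0).
Hypothesis ref : forall n, refines (lv n) (lv n.+1) (e n).
Hypothesis blocks : forall n0, exists2 n, (n0 <= n)%N & positive_block e n N B.
Hypothesis base0 : forall x, J0 x = in_base (lv 0) x.
Hypothesis F0 : forall k x, (k < 5)%N -> in_piece (lv 0) k x ->
  F x = x + shift (lv 0) k.

Let nonempty : exists x, J0 x.
Proof. by exists 0; rewrite /J0 lexx. Qed.

(** The future distribution function; the default 0 is never taken, since [ray_frequency] provides a
    frequency. *)
Let G (t : R) : R := xget 0 [set g | frequency F J0 \1_`]-oo, t] g].

(** The ray is open for [true] and closed for [false]. *)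
Let ray b (t : R) : set R := [set` Interval -oo%O (BSide b t)].

Let downset_ray b t : downset (ray b t).
Proof.
move=> x y; rewrite /ray /= !in_itv /=; case: b => /= yt xy.
  exact: le_lt_trans yt.
exact: le_trans yt.
Qed.

Let ray_frequency b t : exists g, frequency F J0 \1_(ray b t) g.
Proof. exact: (downset_frequency nonempty tower0 ref blocks (@downset_ray b t)). Qed.

Let G_frequency t : frequency F J0 \1_`]-oo, t] (G t).
Proof. by have [g fg] := ray_frequency false t; rewrite /G; apply: xgetPex; exists g. Qed.

(** The closed ray at b minus the open ray at a is the interval [a, b], whose frequency is small. *)
Let short_interval (eps : R) : 0 < eps ->
  exists2 d : R, 0 < d & forall a b, a <= b -> b < a + d ->
    forall g, frequency F J0 \1_(ray true a) g -> G b <= g + eps.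
Proof.
move=> eps0.
have [d d0 hd] := short_interval_frequency nonempty tower0 ref blocks eps0.
exists d => // a b ab bd g fg; rewrite -lerBlDl; apply: (hd a b) => //.
apply: eq_frequency (frequencyD (G_frequency b) (frequencyN fg)) => // x _.
have E : (x \in [set x | a <= x <= b]) = (a <= x <= b).
  by apply/idP/idP => [/set_mem|h] //; apply/mem_set.
rewrite !indicE E /ray !mem_setE !in_itv /=.
have [xa|ax] := ltP x a; last by rewrite /= subr0.
by rewrite (le_trans (ltW xa) ab) /= subrr.
Qed.

(** Points have frequency 0, so open and closed rays have the same frequency. *)
Let G_left t : frequency F J0 \1_(ray true t) (G t).
Proof.
have [g fg] := ray_frequency true t.
suff -> : G t = g by [].
apply/le_anti/andP; split; last first.
  apply: (frequency_le stable nonempty _ fg (G_frequency t)) => y _.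
  rewrite !indicE ler_nat /ray !mem_setE !in_itv /=.
  by case: ltP => //= /ltW ->.
apply/ler_addgt0Pr => eps /short_interval [d d0 hd].
by apply: hd fg => //; rewrite ltrDl.
Qed.

Let G_nondecreasing : {homo G : x y / x <= y}.
Proof.
move=> x y xy; apply: (frequency_le stable nonempty _ (G_frequency x) (G_frequency y)) => z _.
rewrite !indicE ler_nat !mem_setE !in_itv /=.
by case: leP => //= zx; rewrite (le_trans zx).
Qed.

Let G_right_continuous : right_continuous G.
Proof.
move=> a; apply/cvgrPdist_le => eps eps0.
have [d d0 hd] := short_interval eps0.
near=> b.
have ab : a < b by near: b; apply: nbhs_right_gt.
have bd : b < a + d by near: b; apply: nbhs_right_lt; rewrite ltrDl.
rewrite distrC ger0_norm; last by rewrite subr_ge0 G_nondecreasing // ltW.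
by rewrite lerBlDl; apply: hd (G_left a) => //; apply: ltW.
Unshelve. all: by end_near. Qed.

Let G_Ny : G @ -oo --> (0 : R).
Proof.
apply/cvgrPdist_le => eps eps0; near=> t.
have t0 : t < 0 by near: t; apply: nbhs_ninfty_lt; rewrite num_real.
suff -> : G t = 0 by rewrite subrr normr0 ltW.
apply: (frequency_unique stable nonempty (G_frequency t)).
apply: eq_frequency (frequency_cst F J0 0) => // x /andP[x0 _].
by rewrite indicE mem_setE in_itv /= leNgt (lt_le_trans t0).
Unshelve. all: by end_near. Qed.

Let G_y : G @ +oo --> (1 : R).
Proof.
apply/cvgrPdist_le => eps eps0; near=> t.
have t0 : L < t by near: t; apply: nbhs_pinfty_gt; rewrite num_real.
suff -> : G t = 1 by rewrite subrr normr0 ltW.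
apply: (frequency_unique stable nonempty (G_frequency t)).
apply: eq_frequency (frequency_cst F J0 1) => // x /andP[_ xL].
by rewrite indicE mem_setE in_itv /= (ltW (lt_trans xL t0)).
Unshelve. all: by end_near. Qed.

Section Invariance.
Variable P : probability R R.
Hypothesis P_cdf : forall t, P `]-oo, t]%classic = (G t)%:E.

Let P_ray b t : P (ray b t) = (G t)%:E.
Proof.
case: b; last exact: P_cdf.
apply/eqP; rewrite eq_le; apply/andP; split.
  rewrite -P_cdf; apply: le_measure; rewrite ?inE; try exact: measurable_itv.
  by move=> x; rewrite /ray /= !in_itv /= => /ltW.
apply/lee_addgt0Pr => eps eps0.
have [d d0 hd] := short_interval eps0.
pose a := t - d / 2.
have d2 : 0 < d / 2 by rewrite divr_gt0.
have : G t <= G a + eps by apply: hd (G_left a); rewrite /a; lra.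
rewrite -lee_fin EFinD => /le_trans; apply; apply: leeD => //.
rewrite -P_cdf; apply: le_measure; rewrite ?inE; try exact: measurable_itv.
by move=> x; rewrite /ray /= !in_itv /= /a => ?; lra.
Qed.

(** Such sets are the traces on a piece of the preimage of a closed ray, because [F] translates the
    piece. *)
Let interval_frequency p q s : p < q ->
  exists2 g, frequency F J0 \1_[set x | p <= x < q /\ x <= s] g &
    measurable [set x | p <= x < q /\ x <= s] /\
    P [set x | p <= x < q /\ x <= s] = g%:E.
Proof.
move=> pq; set I : set R := [set x | _].
have [ps|sp] := leP p s; last first.
  have I0 : I = set0.
    by rewrite predeqE => x; split => // -[/andP[px _] xs]; move: px xs sp; lra.
  exists 0; last by rewrite I0 measure0.
  by apply: eq_frequency (frequency_cst F J0 0) => // x _; rewrite I0 indic0.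
pose A := if q <= s then ray true q else ray false s.
have [m Am fm] : exists2 m, P A = (G m)%:E & frequency F J0 \1_A (G m).
  rewrite /A; case: ifP => _; first by exists q => //; apply: G_left.
  by exists s; [exact: P_ray|exact: G_frequency].
have mA : measurable A by rewrite /A; case: ifP => _; apply: measurable_itv.
have AE x : A x <-> x < q /\ x <= s.
  rewrite /A; case: (leP q s) => qs; rewrite /ray /= in_itv /=; split.
  - by move=> h; split=> //; apply: le_trans qs; apply: ltW.
  - by case.
  - by move=> h; split=> //; apply: le_lt_trans qs.
  - by case.
have mr : measurable (ray true p) by apply: measurable_itv.
have rA : ray true p `<=` A.
  move=> x; rewrite /ray /= in_itv /= => xp; apply/AE.
  by split; move: xp pq ps; lra.
have IE : I = A `\` ray true p.
  rewrite predeqE => x; rewrite /I /setD /= AE /ray /= in_itv /=.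
  split; first by move=> [/andP[px xq] xs]; split=> //; apply/negP; rewrite -leNgt.
  by move=> [[xq xs] /negP]; rewrite -leNgt => ->; rewrite xq.
exists (G m - G p).
  apply: eq_frequency (frequencyD fm (frequencyN (G_left p))) => // x _.
  rewrite IE !indicE in_setD; case: (boolP (x \in ray true p)) => [/set_mem/rA/mem_set ->|_].
    by rewrite /= subrr.
  by rewrite /= subr0 andbT.
rewrite IE; split; first exact: measurableD.
rewrite measureD //; last by rewrite -ge0_fin_numE // fin_num_measure.
by rewrite setIidr // [X in (X - _)%E]Am [X in (_ - X)%E]P_ray -EFinB.
Qed.

Let full_cdf : P J = 1%E.
Proof.
have -> : J = ray true L `\` ray true 0.
  rewrite predeqE => x; rewrite /J /ray /setD /= !in_itv /=.
  split; first by move=> /andP[x0 ->]; split=> //; apply/negP; rewrite -leNgt.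
  by move=> [-> /negP]; rewrite -leNgt => ->.
have m b u : measurable (ray b u) by apply: measurable_itv.
have sub : ray true 0 `<=` ray true L.
  by move=> x; rewrite /ray /= !in_itv /= => x0; apply: lt_trans L0.
rewrite measureD //; last by rewrite -ge0_fin_numE // fin_num_measure.
rewrite setIidr // [X in (X - _)%E]P_ray [X in (_ - X)%E]P_ray -EFinB.
have -> : G 0 = 0.
  apply: (frequency_unique stable nonempty (G_left 0)).
  apply: eq_frequency (frequency_cst F J0 0) => // x /andP[x0 _].
  by rewrite indicE /ray mem_setE in_itv /= ltNge x0.
have -> : G L = 1.
  apply: (frequency_unique stable nonempty (G_left L)).
  apply: eq_frequency (frequency_cst F J0 1) => // x /andP[_ xL].
  by rewrite indicE /ray mem_setE in_itv /= xL.
by rewrite subr0.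
Qed.

(** The preimage is a disjoint union of five intervals whose measures are their frequencies; the sum
    is the frequency of the indicator composed with [F], which equals [G t] by [frequency_comp]. *)
Let ray_invariant t : P (F @^-1` `]-oo, t]) = (G t)%:E.
Proof.
have mA : measurable (F @^-1` `]-oo, t]) 
  by apply: measurable_preimageF; apply: measurable_itv.
have [t1 _ _ _] := tower0.
have inc k : (k < 5)%N -> cut (lv 0) k < cut (lv 0) k.+1 by move=> /t1 [].
pose I k : set R := [set x | cut (lv 0) k <= x < cut (lv 0) k.+1 /\
                           x <= t - shift (lv 0) k].
have /choice[g gI] (k : 'I_5) : exists g,
    [/\ frequency F J0 \1_(I k) g, measurable (I k) & P (I k) = g%:E].
  have [g fg [mI PI]] := interval_frequency (t - shift (lv 0) k) (inc _ (ltn_ord k)).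
  by exists g.
have mI (k : 'I_5) : measurable (I k) by have [] := gI k.
have disj : trivIset [set: 'I_5] (fun k : 'I_5 => I k).
  apply/trivIsetP => i j _ _ /eqP ij; rewrite predeqE => x; split => // -[[xi _] [xj _]].
  by apply: ij; apply/val_inj/(piece_unique inc _ _ xi xj).
have decomp : F @^-1` `]-oo, t] `&` J = \big[setU/set0]_(k < 5) I k.
  rewrite predeqE => x; rewrite -(bigcup_mkord 5 I); split.
    move=> [/=]; rewrite /J /= !in_itv /= => Fx x0.
    have : J0 x := x0; rewrite base0 => /base_piece [k hk xk].
    exists k => //; split=> //.
    by move: Fx; rewrite (F0 hk xk); lra.
  move=> [k hk [xk xt]]; split; rewrite /= ?in_itv /=.
    by rewrite (F0 hk xk); lra.
  have := piece_base inc hk xk; rewrite -base0 => x0.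
  by rewrite /J /= in_itv.
have -> : P (F @^-1` `]-oo, t]) = (\sum_(k < 5) g k)%:E.
  rewrite -(setI_full full_cdf mA) decomp measure_semi_additive_ord //; last first.
    by rewrite -decomp; apply: measurableI => //; apply: measurable_itv.
  by rewrite -sumEFin; apply: eq_bigr => k _; have [] := gI k.
congr (_%:E).
have f1 := frequency_comp (@indic01 _ `]-oo, t]%classic) (G_frequency t).
have f2 : frequency F J0 (fun x => \sum_(k < 5) \1_(I k) x) (\sum_(k < 5) g k).
  by apply: frequency_sum => // k; have [] := gI k.
apply: (frequency_unique stable nonempty f2).
apply: eq_frequency f1 => // x x0.
have : J0 x := x0; rewrite base0 => /base_piece [k hk xk].
rewrite (bigD1 (Ordinal hk)) //= big1 ?addr0 => [|i ik]; last first.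
  rewrite indicE; case: (boolP (x \in I i)) => // /set_mem [xi _].
  by have /eqP := ik; case; apply/val_inj/(piece_unique inc _ _ xi xk).
rewrite !indicE mem_setE in_itv /= (F0 hk xk); congr ((nat_of_bool _)%:R).
apply/idP/idP => [h|/set_mem [_ h]]; last by lra.
by apply/mem_set; split => //; lra.
Qed.

Lemma cdf_invariant : invariant P.
Proof.
split; first exact: full_cdf.
have mfF := @isMeasurableFun.Build _ _ _ _ F mF.
pose F' : {mfun R >-> R} := HB.pack F mfF.
by apply: (@invariant_rays _ F') => t; rewrite P_cdf; apply: ray_invariant.
Qed.

End Invariance.

Lemma towers_uniquely_ergodic : exists P : probability R R, invariant P /\
  forall Q : probability R R, invariant Q -> forall A, measurable A -> Q A = P A.
Proof.
have [P hP] := cdf_probability G_nondecreasing G_right_continuous G_Ny G_y.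
exists P; split; first exact: cdf_invariant.
move=> Q inv; apply: probability_eq_rays => t.
by rewrite hP; apply: invariant_eq_frequency => //; apply: measurable_itv.
Qed.

End UniqueErgodicity.

(** * Combinatorics of the induction *)

Definition word := seq nat.

(* Symbols are coded by numbers below 8, the underlined letter a by a + 4. *)
Definition code (c : symbol) : nat := (c.1 + c.2 * 4)%N.

Definition letter (c : nat) : nat := if (c < 4)%N then c else (c - 4)%N.

Definition code_pair (v : itm_pair) : word * word := (map code v.1, map code v.2).

(** The step on words is repeated on natural numbers so that finite checks can be evaluated. *)
Definition nsubst (a b : nat) (w : word) : word :=
  flatten [seq if c == a then [:: a; b] else [:: c] | c <- w].

Definition nonce (w : word * word) (a : nat) : bool :=
  [&& (a < 4)%N, count_mem a w.1 == 1%N & count_mem a w.2 == 1%N].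

(* (w', a, b, ii, left): the new words, the winner a and the loser b, whether the
   step is of type (ii) and whether it is a left step. *)
Definition nmove : Type := (word * word * nat * nat * bool * bool)%type.

(* The bit top says that the winner belongs to w_0. *)
Definition nright (w : word * word) (top : bool) : option nmove :=
  let c0 := last 0%N w.1 in
  let c1 := last 0%N w.2 in
  if letter c0 == letter c1 then None
  else if top then
    if nonce w c0 then Some (w.1, nsubst c0 c1 (take 4 w.2), c0, c1, false, false)
    else if (count_mem c0 w.1 == 2%N) && (nth 0%N w.2 3 == letter c0 + 4)%N then
      Some (nsubst c0 c1 (take 4 w.1),
            rcons (nsubst c0 c1 (take 3 w.2)) (letter c1 + 4)%N, c0, c1, true, false)
    else None
  else if nonce w c1 then Some (nsubst c1 c0 (take 4 w.1), w.2, c1, c0, false, false)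
  else None.

Definition gap_position (w : word) : nat := find (fun c => 4 <= c)%N w.

Definition nstep (w : word * word) (top : bool) : option nmove :=
  let p := gap_position w.2 in
  if p \in [:: 3; 4]%N then nright w top
  else if p \in [:: 0; 1]%N then
    if nright (rev w.1, rev w.2) top is Some (w0, w1, a, b, ii, _) then
      Some (rev w0, rev w1, a, b, ii, true) else None
  else None.

Section Moves.
Variables (w : word * word) (m : nmove).
Let w' : word * word := m.1.1.1.1.
Let a := letter m.1.1.1.2.
Let b := letter m.1.1.2.
Let ii : bool := m.1.2.
Let left : bool := m.2.

(* The length of a word before the step in terms of the lengths after the step,
   which differ by a = a' + b. *)
Definition old_letters (u : word) : word :=
  flatten [seq if letter c == a then [:: a; b] else [:: letter c] | c <- u].
(* What a left step cuts off at the left end. *)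
Definition offset_letters : word :=
  if left then if ii then [:: a; b] else [:: b] else [::].

(** [P k] and [Q k] are the left ends of the old piece [k] and of its image, counted from the old
    base; the primed versions belong to the new map and are counted from the new base, at distance
    [O]. *)
Let P k := old_letters (take k w.1).
Let Q k := old_letters (take (index (nth 0%N w.1 k) w.2) w.2).
Let P' k := map letter (take k w'.1).
Let Q' k := map letter (take (index (nth 0%N w'.1 k) w'.2) w'.2).
Let L' := map letter w'.1.
Let O := offset_letters.

Definition leqw (u u' : word) : bool :=
  all (fun i => count_mem i u <= count_mem i u')%N u.

(** Terms are moved across the inequalities to avoid subtraction. The inequalities put the new piece
    inside [j] and its image inside [i]; the disjunction puts that image to the right or to the left
    of the new base; the permutation compares translations. *)
Definition visit_ok (k : nat) (e : seq nat) : bool :=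
  match e with
  | [:: j] =>
      [&& (j < 5)%N, leqw (P j) (O ++ P' k), leqw (O ++ P' k.+1) (P j.+1) &
          perm_eq (Q' k ++ P j) (Q j ++ P' k)]
  | [:: j; i] =>
      [&& (j < 5)%N, (i < 5)%N, leqw (P j) (O ++ P' k),
          leqw (O ++ P' k.+1) (P j.+1),
          leqw (P i ++ P j) (O ++ P' k ++ Q j),
          leqw (O ++ P' k.+1 ++ Q j) (P i.+1 ++ P j),
          leqw (O ++ L' ++ P j) (O ++ P' k ++ Q j) ||
          leqw (O ++ P' k.+1 ++ Q j) (O ++ P j) &
          perm_eq (Q' k ++ P j ++ P i) (Q j ++ Q i ++ P' k)]
  | _ => false
  end.

(** If the translation of the containing piece is not the new one, the point falls into the part cut
    off, hence into the extreme old piece. *)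
Definition move_visits (k : nat) : seq nat :=
  let j := find (fun j => if leqw (P j) (O ++ P' k) then leqw (O ++ P' k.+1) (P j.+1)
                          else false) (iota 0 5) in
  if perm_eq (Q' k ++ P j) (Q j ++ P' k) then [:: j]
  else [:: j; if left then 0%N else 4%N].

(* The inequalities between lengths that make the new map an induced map of the
   old one hold coefficientwise in the new lengths, hence for all of them. *)
Definition move_ok : bool :=
  [&& size w.1 == 5%N, size w'.1 == 5%N, leqw (O ++ L') (P 5),
      all (fun k => visit_ok k (move_visits k)) (iota 0 5),
      all (fun k => leqw (Q' k ++ [:: letter (nth 0%N w'.1 k)]) L') (iota 0 5),
      (if left then leqw O (P 1) && leqw (P 5) (O ++ L') else leqw (P 4) L') &
      let k := if left then 0%N else 4%N in
      leqw O (Q k) && leqw (Q k ++ P k.+1) (O ++ L' ++ P k)].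

End Moves.

(** Letters are renamed by the order of the plain letters of w_1, so pairs that differ by a renaming
    get the same form. *)
Definition canon (w : word * word) : word * word :=
  let plain := [seq c <- w.2 | c < 4]%N in
  let f c := if (c < 4)%N then index c plain else (index (c - 4) plain + 4)%N in
  (map f w.1, map f w.2).

Definition all_words : seq (word * word) :=
  flatten [seq [seq (x, y) | x <- permutations [:: alpha; 0; 1; 2; 3]%N,
                             y <- permutations [:: alpha + 4; 0; 1; 2; 3]%N]
          | alpha <- iota 0 4].
Definition is_word_pair (w : word * word) : bool :=
  let alpha := (nth 0 w.2 (gap_position w.2) - 4)%N in
  [&& (alpha < 4)%N, perm_eq w.1 (alpha :: iota 0 4) &
      perm_eq w.2 ((alpha + 4)%N :: iota 0 4)].

Lemma all_wordsP w : is_word_pair w -> w \in all_words.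
Proof.
case: w => w0 w1 /and3P[/=]; move: (_ - 4)%N => alpha ha p1 p2; apply/flattenP.
exists [seq (x, y) | x <- permutations [:: alpha; 0; 1; 2; 3]%N,
                     y <- permutations [:: alpha + 4; 0; 1; 2; 3]%N].
  by apply/mapP; exists alpha; rewrite ?mem_iota.
by apply: allpairs_f; rewrite mem_permutations.
Qed.

Definition canon_move (o : option nmove) : option (word * word * bool) :=
  if o is Some m then Some (canon m.1.1.1.1, m.1.2) else None.

Definition gap_letter (w : word * word) : nat :=
  letter (nth 0%N w.2 (gap_position w.2)).

Definition each_move (p : word * word -> bool -> nmove -> bool) (w : word * word) : bool :=
  all (fun top => if nstep w top is Some m then p w top m else true) [:: true; false].

(** The middle clause lets a step be followed on canonical pairs; the last one is the combinatorial
    half of the growth of the doubled letter. *)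
Definition move_consistent (w : word * word) (top : bool) (m : nmove) : bool :=
  [&& is_word_pair m.1.1.1.1,
      canon_move (nstep (canon w) top) == canon_move (Some m) &
      ~~ m.1.2 ==> (gap_letter m.1.1.1.1 == gap_letter w) &&
                   (letter m.1.1.1.2 != gap_letter w)].

Lemma all_words_consistent : all (each_move move_consistent) all_words.
Proof. by vm_compute. Qed.

Lemma move_consistentP w top m : is_word_pair w -> nstep w top = Some m ->
  move_consistent w top m.
Proof.
move=> /all_wordsP/(allP all_words_consistent)/allP/(_ top) + mE; rewrite mE.
by apply; case: top {mE}.
Qed.

Definition canonical_words : seq (word * word) := [seq w <- all_words | canon w == w].

Lemma canon_canonical :
  all (fun w => is_word_pair (canon w) && (canon (canon w) == canon w)) all_words.
Proof. by vm_compute. Qed.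

Lemma canonical_wordsP w : is_word_pair w -> canon w \in canonical_words.
Proof.
move=> /all_wordsP/(allP canon_canonical)/andP[cw cc].
by rewrite mem_filter cc all_wordsP.
Qed.

(** * States reachable after a given number of marked transitions *)

Section Stages.
Variables (T : eqType) (next : T -> bool -> option (T * bool)) (fuel : nat).

Definition successors (x : T) : seq T :=
  pmap (fun top => omap fst (next x top)) [:: true; false].

Definition marked_successors (x : T) : seq T :=
  pmap (fun top => if next x top is Some (y, true) then Some y else None)
    [:: true; false].

(** A graph search with generous fuel; that its result is really closed is certified afterwards by
    [closed_stages]. *)
Fixpoint closure (n : nat) (todo seen : seq T) : seq T :=
  if n is n'.+1 then
    if todo is x :: todo' then
      if x \in seen then closure n' todo' seen
      else closure n' (successors x ++ todo') (x :: seen)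
    else seen
  else seen.

(** Meant as the states reached by one marked transition and then arbitrary ones; marks will be the
    steps of type (ii). *)
Definition next_stage (S : seq T) : seq T :=
  closure fuel (flatten (map marked_successors S)) [::].

Definition closed_stage (S : seq T) : bool :=
  all (fun x => all (mem S) (successors x)) S.

Fixpoint closed_stages (m : nat) (S : seq T) : bool :=
  if m is m'.+1 then
    let S' := next_stage S in
    [&& all (fun x => all (mem S') (marked_successors x)) S,
        closed_stage S' & closed_stages m' S']
  else true.

Variables (x : nat -> T) (top ii : nat -> bool).
Hypothesis run : forall n, next (x n) (top n) = Some (x n.+1, ii n).

Let run_successor n : x n.+1 \in successors (x n).
Proof.
rewrite mem_pmap; apply/mapP; exists (top n); last by rewrite run.
by case: (top n).
Qed.

Let run_marked n : ii n -> x n.+1 \in marked_successors (x n).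
Proof.
move=> hn; rewrite mem_pmap; apply/mapP; exists (top n); first by case: (top n).
by rewrite run hn.
Qed.

Lemma closed_stage_run S n : closed_stage S -> x n \in S ->
  forall k, x (n + k)%N \in S.
Proof.
move=> /allP cl xn; elim=> [|k IH]; first by rewrite addn0.
by rewrite addnS; apply: (allP (cl _ IH)); apply: run_successor.
Qed.

Lemma closed_stages_nth m S j : closed_stages m S -> (j < m)%N ->
  all (fun x => all (mem (iter j.+1 next_stage S)) (marked_successors x))
    (iter j next_stage S) && closed_stage (iter j.+1 next_stage S).
Proof.
elim: m S j => // m IH S [|j] /and3P[h1 h2 h3] jm; first by rewrite h1 h2.
by have := IH _ _ h3 jm; rewrite -!iterSr.
Qed.

Lemma last_stage_run m S n : (0 < m)%N -> closed_stages m S ->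
  x n \in iter m next_stage S -> forall k, x (n + k)%N \in iter m next_stage S.
Proof.
case: m => // m _ /closed_stages_nth /(_ (ltnSn m)) /andP[_ cl] xn.
exact: closed_stage_run cl xn.
Qed.

(** At each time either the mark count was already large enough and the stage is closed, or the last
    transition is marked and enters the next stage. *)
Lemma stage_run m S n : closed_stages m S -> (forall k, x k \in S) ->
  (m <= \sum_(i < n) ii i)%N -> x n \in iter m next_stage S.
Proof.
move=> cl xS; suff H j : (j <= m)%N -> (j <= \sum_(i < n) ii i)%N ->
    x n \in iter j next_stage S by apply: H.
elim: n j => [|n IH] [|j] jm //; first by rewrite big_ord0.
rewrite big_ord_recr /= => le.
have /andP[/allP mk /allP cj] := closed_stages_nth cl jm.
case: (leqP j.+1 (\sum_(i < n) ii i)) => le'.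
  exact: (allP (cj _ (IH _ jm le'))) (run_successor n).
have iin : ii n by move: le le'; case: (ii n) => //=; lia.
have xn : x n \in iter j next_stage S.
  by apply: IH; [exact: ltnW|move: le; rewrite iin addn1].
exact: (allP (mk _ xn)) (run_marked iin).
Qed.

End Stages.

Definition word_next (w : word * word) (top : bool) := canon_move (nstep w top).

(* The pairs of words, up to renaming the letters, that occur after three steps of
   type (ii). *)
Definition core : seq (word * word) :=
  iter 3 (next_stage word_next (100 * 200)) canonical_words.

Lemma core_stages : closed_stages word_next (100 * 200) 3 canonical_words.
Proof. by vm_compute. Qed.

Section CoreRun.
Variables (x : nat -> word * word) (top ii : nat -> bool).
Hypothesis run : forall n, word_next (x n) (top n) = Some (x n.+1, ii n).

Lemma core_reached n : (forall k, x k \in canonical_words) ->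
  (3 <= \sum_(i < n) ii i)%N -> x n \in core.
Proof. exact: (stage_run run core_stages). Qed.

Lemma core_kept n k : x n \in core -> x (n + k)%N \in core.
Proof. by rewrite /core => xn; exact: (last_stage_run run (isT : 0 < 3)%N core_stages xn k). Qed.

End CoreRun.

(** Independence of the itineraries from the names of the letters is evaluated: the test runs over
    all pairs whose canonical form is in [core]. *)
Lemma core_moves :
  all (fun w => if canon w \in core then
    each_move (fun w top m => move_ok w m &&
      if nstep (canon w) top is Some m' then
        all (fun k => move_visits w m k == move_visits (canon w) m' k) (iota 0 5)
      else false) w else true) all_words.
Proof. by vm_compute. Qed.

Lemma core_moveP w top m : is_word_pair w -> canon w \in core ->
  nstep w top = Some m -> move_ok w m /\
    exists2 m', nstep (canon w) top = Some m' &
      forall k, (k < 5)%N -> move_visits w m k = move_visits (canon w) m' k.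
Proof.
move: core_moves; move: core => C /allP H /all_wordsP /H {H} + wC mE.
rewrite wC /each_move => /allP /(_ top).
have -> : top \in [:: true; false] by case: top {mE}.
rewrite mE => /(_ isT) /andP[ok]; split=> //.
case: (nstep _ _) b => [m'|] // /allP H; exists m' => // k hk.
by apply/eqP/H; rewrite mem_iota.
Qed.

Definition move_entry (C : seq (word * word)) (w : word * word) (top : bool) :
    option (nat * seq (seq nat) * bool) :=
  if nstep w top is Some m then
    Some (index (canon m.1.1.1.1) C, [seq move_visits w m k | k <- iota 0 5], m.1.2)
  else None.

Definition move_table (C : seq (word * word)) :=
  [seq (move_entry C w true, move_entry C w false) | w <- C].

(* A state is the index of a canonical pair of words and the set of the pieces
   whose itinerary in an earlier level visits a given piece. *)
Definition visiting_next (table : seq (option (nat * seq (seq nat) * bool) *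
      option (nat * seq (seq nat) * bool))) (x : nat * seq nat) (top : bool) :
    option (nat * seq nat * bool) :=
  let e := nth (None, None) table x.1 in
  if (if top then e.1 else e.2) is Some (i, its, ii) then
    Some (i, [seq k <- iota 0 5 | has (mem x.2) (nth [::] its k)], ii)
  else None.

Lemma visiting_nextE C w S top m : w \in C -> nstep w top = Some m ->
  visiting_next (move_table C) (index w C, S) top = Some (index (canon m.1.1.1.1) C,
    [seq k <- iota 0 5 | has (mem S) (move_visits w m k)], m.1.2).
Proof.
move=> wC mE; rewrite /visiting_next /move_table (nth_map w) ?index_mem // nth_index //.
by rewrite /move_entry; case: top mE => ->.
Qed.

Definition visiting0 : seq (nat * seq nat) :=
  closure (visiting_next (move_table core)) (100 * 100)
    [seq (i, [:: k]) | i <- iota 0 (size core), k <- iota 0 5] [::].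

(** Starting from a single piece, every path with eleven marked transitions leads to the full set of
    pieces. *)
Lemma visiting_stages :
  [&& closed_stage (visiting_next (move_table core)) visiting0,
      closed_stages (visiting_next (move_table core)) (100 * 100) 11 visiting0,
      all (mem visiting0) [seq (i, [:: k]) | i <- iota 0 (size core), k <- iota 0 5] &
      all (fun x => x.2 == iota 0 5)
        (iter 11 (next_stage (visiting_next (move_table core)) (100 * 100)) visiting0)].
Proof. by vm_compute. Qed.

Lemma visiting_full (x : nat -> nat * seq nat) (top ii : nat -> bool) w j n :
  (forall n, visiting_next (move_table core) (x n) (top n) = Some (x n.+1, ii n)) ->
  w \in core -> (j < 5)%N -> x 0%N = (index w core, [:: j]) ->
  (11 <= \sum_(i < n) ii i)%N -> (x n).2 = iota 0 5.
Proof.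
move: visiting_stages; move: visiting0 core (100 * 100)%N => V C fuel.
move=> /and4P[cl st /allP sub /allP full] run wc hj x0 hn.
have in0 : x 0%N \in V.
  by apply: sub; rewrite x0; apply: allpairs_f; rewrite mem_iota ?index_mem.
have all_in k : x k \in V.
  by have := closed_stage_run run cl in0 k; rewrite add0n.
exact/eqP/full/(stage_run run st all_in hn).
Qed.

(** * From words and lengths to levels *)

Section WordLevels.
Variable R : realType.

Definition wsum (lam : nat -> R) (u : word) : R := \sum_(i <- u) lam i.

Definition word_level (w : word * word) (lam : nat -> R) (o : R) (h : nat -> nat) :
    level R :=
  Level (fun k => o + wsum lam (map letter (take k w.1)))
        (fun k => wsum lam (map letter (take (index (nth 0%N w.1 k) w.2) w.2))
                  - wsum lam (map letter (take k w.1))) h.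

Lemma wsum_cat lam u u' : wsum lam (u ++ u') = wsum lam u + wsum lam u'.
Proof. by rewrite /wsum big_cat. Qed.

Lemma wsum_perm lam u u' : perm_eq u u' -> wsum lam u = wsum lam u'.
Proof. exact: perm_big. Qed.

Lemma wsum_le lam u u' : (forall i, 0 <= lam i) -> leqw u u' ->
  wsum lam u <= wsum lam u'.
Proof.
move=> lam0; elim: u u' => [|i u IH] u' le.
  by rewrite /wsum big_nil sumr_ge0.
have iu' : i \in u'.
  rewrite -has_pred1 has_count; move: le => /= /andP[le _].
  by apply: leq_trans le; rewrite /= eqxx.
have pu := perm_to_rem iu'.
rewrite (wsum_perm lam pu) /wsum !big_cons lerD2l; apply: IH.
apply/allP => j ju; have := allP le j; rewrite inE ju orbT => /(_ isT).
by rewrite (permP pu) /= leq_add2l.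
Qed.

Lemma wsum_ge0 lam u : (forall i, 0 <= lam i) -> 0 <= wsum lam u.
Proof. by move=> lam0; apply: sumr_ge0 => i _. Qed.

Variables (w : word * word) (m : nmove) (lam lam' : nat -> R) (o : R) (h : nat -> nat).
Local Notation w' := m.1.1.1.1.
Local Notation a := (letter m.1.1.1.2).
Local Notation b := (letter m.1.1.2).
Local Notation left := m.2.
Hypothesis lam'0 : forall i, 0 < lam' i.
Hypothesis lamE : forall i, lam i = lam' i + (if i == a then lam' b else 0).
Hypothesis ok : move_ok w m.

Lemma wsum_old u : wsum lam (map letter u) = wsum lam' (old_letters m u).
Proof.
rewrite /old_letters /wsum; elim: u => [|c u IH] /=; first by rewrite !big_nil.
rewrite big_cat big_cons IH lamE; congr (_ + _).
by case: eqP => [->|_]; rewrite !big_cons big_nil /= ?addr0.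
Qed.

(** By [wsum_old] everything is expanded in the positive lengths [lam'] after the step; [wsum_le]
    turns the word inequalities into real ones, and each clause becomes linear arithmetic. *)
Lemma move_refines :
  refines (word_level w lam o h)
    (word_level w' lam' (o + wsum lam' (offset_letters m))
       (fun k => \sum_(j <- move_visits w m k) h j)%N)
    (move_visits w m).
Proof.
have l0 i : 0 <= lam' i by apply: ltW.
have leq u u' : leqw u u' -> wsum lam' u <= wsum lam' u' by apply: wsum_le.
have eqw u u' := @wsum_perm lam' u u'.
have pos u : 0 <= wsum lam' u by apply: wsum_ge0.
move: ok; rewrite /move_ok => /and5P[/eqP s5 /eqP s5' sub /allP vis].
move=> /and3P[/allP stay ent ent'].
have take5 : take 5 w.1 = w.1 by rewrite -s5 take_size.
have take5' : take 5 w'.1 = w'.1 by rewrite -s5' take_size.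
have baseE x : in_base (word_level w' lam' (o + wsum lam' (offset_letters m))
       (fun k => \sum_(j <- move_visits w m k) h j)%N) x =
    (o + wsum lam' (offset_letters m) <= x <
     o + wsum lam' (offset_letters m) + wsum lam' (map letter w'.1)).
  by rewrite /in_base /= take0 take5' /wsum big_nil addr0.
have baseE0 x : in_base (word_level w lam o h) x =
    (o <= x < o + wsum lam' (old_letters m w.1)).
  by rewrite /in_base /= take0 take5 -wsum_old /wsum big_nil addr0.
have mem5 k : (k < 5)%N -> k \in iota 0 5 by rewrite mem_iota.
split.
- move=> x; rewrite baseE baseE0.
  have := leq _ _ sub; rewrite take5 wsum_cat.
  have p1 := pos (offset_letters m); move=> p2 /andP[h1 h2].
  by apply/andP; split; lra.
- move=> k hk; have := vis _ (mem5 _ hk).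
  rewrite /visits /in_piece /=.
  case: (move_visits w m k) => [|j [|i [|? ?]]] //=.
    move=> /and4P[hj /leq p1 /leq p2 /eqw p3].
    left; exists j; rewrite /= !wsum_old big_seq1; move: p1 p2 p3; rewrite !wsum_cat.
    split=> //; last by lra.
    by move=> x /andP[? ?]; apply/andP; split; lra.
  move=> /and5P[hj hi /leq p1 /leq p2 /and4P[/leq p3 /leq p4 p5 /eqw p6]].
  right; exists j, i; rewrite /= !wsum_old !big_cons big_nil addn0 hj hi.
  move: p1 p2 p3 p4 p6; rewrite !wsum_cat => p1 p2 p3 p4 p6.
  split=> //; last by lra.
  move=> x /andP[? ?]; split; try by apply/andP; split; lra.
  rewrite baseE; case/orP: p5 => /leq; rewrite !wsum_cat => p5.
    by apply/negP => /andP[_]; lra.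
  by apply/negP => /andP[+ _]; lra.
- move=> k x hk; rewrite baseE /in_piece /=.
  have := leq _ _ (stay _ (mem5 _ hk)); rewrite wsum_cat.
  have -> : map letter (take k.+1 w'.1) =
            map letter (take k w'.1) ++ [:: letter (nth 0%N w'.1 k)].
    by rewrite (take_nth 0%N) ?s5' // map_rcons cats1.
  rewrite !wsum_cat.
  have := pos (map letter (take (index (nth 0%N w'.1 k) w'.2) w'.2)).
  by move=> p1 p2 /andP[h1 h2]; apply/andP; split; lra.
- move=> x; rewrite baseE0 baseE => /andP[x1 x2] x3.
  have eqL := leq _ _ sub; rewrite take5 wsum_cat in eqL.
  pose k := if left then 0%N else 4%N.
  case/andP: ent' => /leq q1 /leq q2; rewrite !wsum_cat -/k in q1 q2.
  exists k; rewrite baseE /in_piece /= !wsum_old.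
  (* What the step cuts off lies in the extreme piece [k], whose image lies in the new base by [q1]
     and [q2]. *)
  have hx : o + wsum lam' (old_letters m (take k w.1)) <= x <
            o + wsum lam' (old_letters m (take k.+1 w.1)).
    move: x3; rewrite negb_and -ltNge -leNgt /k.
    move: ent; case E : (left).
      move=> /andP[/leq p /leq p']; rewrite take5 wsum_cat in p'.
      rewrite take0 /= [wsum lam' [::]]big_nil addr0 x1 /= => /orP[?|?]; lra.
    have off0 : wsum lam' (offset_letters m) = 0.
      by rewrite /offset_letters E [LHS]big_nil.
    by move=> /leq p; rewrite take5 x2 andbT off0 => /orP[?|?]; lra.
  split=> //; first by rewrite /k; case: (left).
  by move: hx => /andP[h1 h2]; apply/andP; split; lra.
- move=> k hk /=; rewrite (take_nth 0%N) ?s5' // map_rcons -cats1 wsum_cat.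
  by rewrite addrA ltrDl /wsum big_seq1.
Qed.

End WordLevels.

(** * Measurability and recurrence *)

Lemma measurable_inv (R : realType) : measurable_fun setT (fun x : R => x^-1).
Proof.
have oU : open [set x : R | x != 0] by apply: open_neq.
have mU := open_measurable oU.
have -> : [set: R] = [set x : R | x != 0] `|` [set 0].
  by rewrite predeqE => x; split => // _; case: (eqVneq x 0) => ?; [right|left].
apply/measurable_funU => //; split; last exact: measurable_fun_set1.
apply: open_continuous_measurable_fun => // x; rewrite inE => x0.
exact: inv_continuous.
Qed.

Section CountableSections.
Variables (R : realType) (d : measure_display) (Z : measurableType d).

Lemma countable_itm_pair : countable [set: itm_pair].
Proof.
have : countable [set: seq symbol * seq symbol] by apply: countableP.
by [].
Qed.

(** There are countably many pairs of words, with the discrete sigma-algebra. *)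
Lemma measurable_sections (A : set (base R)) :
  (forall v, measurable [set l | A (v, l)]) -> measurable A.
Proof.
move=> mA; have -> : A = \bigcup_v ([set v] `*` [set l | A (v, l)]).
  rewrite predeqE => -[v l]; split; first by move=> Avl; exists v.
  by move=> [w _ [/= <-]].
apply: countable_bigcupT_measurable; first exact: countable_itm_pair.
by move=> v; apply: measurableX.
Qed.

Lemma measurable_fun_sections (f : base R -> Z) :
  (forall v, measurable_fun setT (fun l => f (v, l))) -> measurable_fun setT f.
Proof.
move=> mf _ A mA; rewrite setTI; apply: measurable_sections => v.
by have := mf v measurableT A mA; rewrite setTI.
Qed.

End CountableSections.

Section Measurability.
Variable R : realType.

Definition winner_on_top (v : itm_pair) (l : 4.-tuple R) : bool :=
  let p := find (fun c : symbol => c.2) v.2 in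
  if p \in [:: 3; 4]%N
  then tnth l (last symbol0 v.2).1 < tnth l (last symbol0 v.1).1
  else tnth l (last symbol0 (rev v.2)).1 < tnth l (last symbol0 (rev v.1)).1.

Definition branch (l : 4.-tuple R) (o : option (itm_pair * symbol * symbol)) :=
  omap (fun y : itm_pair * symbol * symbol => (y.1.1, new_lengths l y.1.2 y.2)) o.

(* On a fixed pair of words only the order of two lengths decides about the step. *)
Definition step_branches (v : itm_pair) : Prop :=
  exists (i j : 'I_4) (o1 o2 : option (itm_pair * symbol * symbol)),
    forall l : 4.-tuple R, induction_step v l =
      if tnth l j < tnth l i then branch l o1
      else if tnth l i < tnth l j then branch l o2 else None.

Lemma step_branchesP v : step_branches v.
Proof.
have R0 (u : itm_pair) : exists (i j : 'I_4) (o1 o2 : option (itm_pair * symbol * symbol)),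
    forall l : 4.-tuple R, right_step u l =
      if tnth l j < tnth l i then branch l o1
      else if tnth l i < tnth l j then branch l o2 else None.
  exists (last symbol0 u.1).1, (last symbol0 u.2).1.
  set c0 := last symbol0 u.1; set c1 := last symbol0 u.2.
  exists (if once_in_both u c0 then Some (u.1, subst c0 c1 (take 4 u.2), c0, c1)
    else if (count_mem c0 u.1 == 2%N) && (nth symbol0 u.2 3 == underlined c0.1)
    then Some (subst c0 c1 (take 4 u.1),
               rcons (subst c0 c1 (take 3 u.2)) (underlined c1.1), c0, c1) else None).
  exists (if once_in_both u c1 then Some (subst c1 c0 (take 4 u.1), u.2, c1, c0) else None).
  move=> l; rewrite /right_step -/c0 -/c1.
  case: ifP => _; first by case: ifP => // _; case: ifP.
  by case: ifP => // _; case: ifP.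
rewrite /step_branches /induction_step /left_step.
set p := find _ _.
case: (p \in [:: 3; 4]%N); first exact: R0.
case: (p \in [:: 0; 1]%N); last first.
  by exists ord0, ord0, None, None => l; rewrite ltxx.
have [i [j [ o1 [ o2 H]]]] := R0 (mirror v).
pose mir := omap (fun y : itm_pair * symbol * symbol => (mirror y.1.1, y.1.2, y.2)).
exists i, j, (mir o1), (mir o2) => l; rewrite H.
case: ifP => _; first by case: (o1).
by case: ifP => _ //; case: (o2).
Qed.

Lemma measurable_tnth_fun (a : 'I_4) : measurable_fun setT (fun l : 4.-tuple R => tnth l a).
Proof. exact: measurable_tnth. Qed.

Lemma measurable_T : measurable_fun setT (@T R).
Proof.
apply: measurable_fun_sections => v.
have [i [j [ o1 [ o2 H]]]] := step_branchesP v.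
have mb (o : option (itm_pair * symbol * symbol)) : measurable_fun setT (fun l : 4.-tuple R =>
    if o is Some y then (y.1.1, [tuple tnth (new_lengths l y.1.2 y.2) a /
       lnorm (new_lengths l y.1.2 y.2) | a < 4]) else (v, l)).
  case: o => [[[v' a] b]|] /=; last first.
    by apply: measurable_fun_pair.
  apply: measurable_fun_pair => //; apply/measurable_fun_tnthP => k.
  have mn (c : 'I_4) : measurable_fun setT (fun l : 4.-tuple R => tnth (new_lengths l a b) c).
    under eq_fun do rewrite tnth_mktuple.
    case: eqP => _; last exact: measurable_tnth_fun.
    by apply: measurable_funB; apply: measurable_tnth_fun.
  have E : (fun l : 4.-tuple R => tnth [tuple tnth (new_lengths l a b) c / lnorm (new_lengths l a b)
      | c < 4] k) = (fun l : 4.-tuple R => tnth (new_lengths l a b) k * (lnorm (new_lengths l a b))^-1).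
    by apply/funext => l; rewrite tnth_mktuple.
  rewrite /comp E; apply: measurable_funM; first exact: mn.
  by apply: (measurableT_comp (@measurable_inv R)); apply: measurable_sum => c; apply: mn.
have -> : (fun l : 4.-tuple R => T (v, l)) = (fun l => if tnth l j < tnth l i then
    (if o1 is Some y then (y.1.1, [tuple tnth (new_lengths l y.1.2 y.2) a /
       lnorm (new_lengths l y.1.2 y.2) | a < 4]) else (v, l))
    else if tnth l i < tnth l j then
    (if o2 is Some y then (y.1.1, [tuple tnth (new_lengths l y.1.2 y.2) a /
       lnorm (new_lengths l y.1.2 y.2) | a < 4]) else (v, l)) else (v, l)).
  apply/funext => l; rewrite /T /proj_step /= H.
  by case: ifP => _; [case: (o1)|case: ifP => _ //; case: (o2)].
have mlt (c c' : 'I_4) : measurable_fun setT (fun l : 4.-tuple R => tnth l c < tnth l c').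
  by apply: measurable_fun_ltr; apply: measurable_tnth_fun.
apply: measurable_fun_ifT; [exact: mlt|exact: (mb o1)|].
by apply: measurable_fun_ifT; [exact: mlt|exact: (mb o2)|exact: (mb None)].
Qed.

Lemma measurable_winner_on_top v :
  measurable_fun setT (fun l : 4.-tuple R => winner_on_top v l).
Proof.
rewrite /winner_on_top; set p := find _ _; case: (p \in _);
  by apply: measurable_fun_ltr; apply: measurable_tnth_fun.
Qed.

End Measurability.

Section Recurrence.
Variables (R : realType) (d : measure_display) (Y : measurableType d).
Variables (mu : probability Y R) (f : Y -> Y).
Hypothesis mf : measurable_fun setT f.
Hypothesis inv : forall A, measurable A -> mu (f @^-1` A) = mu A.

Lemma measurable_preimage_iter A n : measurable A -> measurable (iter n f @^-1` A).
Proof.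
move=> mA; elim: n => [|n IH] //.
rewrite (_ : _ @^-1` A = f @^-1` (iter n f @^-1` A)).
  by rewrite -[X in measurable X]setTI; apply: mf.
by rewrite predeqE => x /=; rewrite -iterSr.
Qed.

Lemma measure_preimage_iter A n : measurable A -> mu (iter n f @^-1` A) = mu A.
Proof.
move=> mA; elim: n => [|n IH] //.
rewrite -IH -[RHS]inv; last exact: measurable_preimage_iter.
by congr (mu _); rewrite predeqE => x /=; rewrite -iterSr.
Qed.

(** The points [W] of A that never return have disjoint preimages of equal measure, so [W] is null;
    taking all preimages covers every starting time [m]. *)
Lemma poincare_recurrence A : measurable A ->
  {ae mu, forall x, forall m, A (iter m f x) ->
     exists2 n, (m < n)%N & A (iter n f x)}.
Proof.
move=> mA.
pose W := A `&` \bigcap_n (iter n.+1 f @^-1` ~` A).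
have mW : measurable W.
  apply: measurableI => //; apply: bigcapT_measurable => n.
  by apply: measurable_preimage_iter; apply: measurableC.
have disj : trivIset setT (fun m => iter m f @^-1` W).
  apply/trivIsetP => i j _ _; wlog ij : i j / (i < j)%N.
    move=> H; case: (ltngtP i j) => // ij _; first by apply: H => //; rewrite ltn_eqF.
    by rewrite setIC; apply: H => //; rewrite ltn_eqF.
  move=> _; rewrite predeqE => x; split => // -[[_ /= Wi] [Aj _]].
  apply: (Wi (j - i.+1)%N I); rewrite /= -iterS -iterD.
  by rewrite (_ : ((j - i.+1).+1 + i = j)%N) //; lia.
have W0 : mu W = 0%E.
  pose p := fine (mu W).
  have pE : mu W = p%:E by rewrite fineK // fin_num_measure.
  have p0 : 0 <= p by rewrite -lee_fin -pE.
  have bound n : p * n%:R <= 1.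
    have mU : measurable (\big[setU/set0]_(i < n) (iter i f @^-1` W)).
      by apply: bigsetU_measurable => i _; apply: measurable_preimage_iter.
    have := probability_le1 mu mU.
    rewrite measure_semi_additive_ord //; last 2 first.
    - by move=> i; apply: measurable_preimage_iter.
    - by move=> i j _ _ [x [xi xj]]; apply/val_inj/(disj _ _ I I); exists x.
    have E (i : 'I_n) : mu (iter i f @^-1` W) = p%:E by rewrite measure_preimage_iter.
    rewrite (eq_bigr (fun=> p%:E)); last by move=> i _; apply: E.
    by rewrite sumEFin sumr_const card_ord lee_fin mulr_natr.
  rewrite pE; congr (_%:E); apply/eqP; rewrite eq_le p0 andbT leNgt; apply/negP => pp.
  have := bound (Num.bound p^-1); apply/negP; rewrite -ltNge.
  by rewrite mulrC -ltr_pdivrMr // div1r archi_boundP // invr_ge0.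
have : mu.-negligible (\bigcup_m (iter m f @^-1` W)).
  apply: negligible_bigcup => m; exists (iter m f @^-1` W); split => //.
    exact: measurable_preimage_iter.
  exact: etrans (measure_preimage_iter m mW) W0.
apply: negligibleS => x /= /existsNP [m /not_implyP [Am no]].
exists m => //; split => // n _ /= An; apply: no; exists (n.+1 + m)%N; first by lia.
by rewrite iterD.
Qed.

End Recurrence.

(** * Orbits of the induction *)

Lemma letter_code c : letter (code c) = c.1.
Proof.
case: c => a [] /=; rewrite /letter /code /=; last by rewrite mul0n addn0 ltn_ord.
by rewrite ltnNge leq_addl /= addnK.
Qed.

Lemma code_inj : injective code.
Proof.
move=> [a u] [b w]; rewrite /code /= => E; have := ltn_ord a; have := ltn_ord b.
move: E; case: u; case: w => /=; rewrite ?mul0n ?mul1n ?addn0 => E hb ha.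
- by move/addIn: E => /val_inj ->.
- by exfalso; lia.
- by exfalso; lia.
- by rewrite (val_inj E).
Qed.

Lemma code_gap c : (4 <= code c)%N = c.2.
Proof.
case: c => a []; rewrite /code /= ?mul0n ?addn0; first by rewrite leq_addl.
by rewrite leqNgt ltn_ord.
Qed.

Lemma nth_code w i : nth 0%N (map code w) i = code (nth symbol0 w i).
Proof.
case: (ltnP i (size w)) => hi; first exact: nth_map.
by rewrite !nth_default ?size_map.
Qed.

Lemma last_code w : last 0%N (map code w) = code (last symbol0 w).
Proof. exact: (last_map code w symbol0). Qed.

Lemma count_code a w : count_mem (code a) (map code w) = count_mem a w.
Proof. by rewrite count_map; apply: eq_count => c /=; rewrite (inj_eq code_inj). Qed.

Lemma subst_code a b w : map code (subst a b w) = nsubst (code a) (code b) (map code w).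
Proof.
rewrite /subst /nsubst; elim: w => //= c w IH.
by rewrite map_cat IH (inj_eq code_inj); case: ifP.
Qed.

Lemma nonce_code v a : nonce (code_pair v) (code a) = once_in_both v a.
Proof. by rewrite /nonce /once_in_both !count_code ltnNge code_gap. Qed.

Lemma underlined_code (a : 'I_4) c : (code c == a + 4)%N = (c == underlined a).
Proof.
by rewrite -(inj_eq code_inj).
Qed.

Section Steps.
Variable R : realType.
Implicit Types (v : itm_pair) (l : 4.-tuple R).

Lemma right_step_code v l v' l' : right_step v l = Some (v', l') ->
  exists a b ii, [/\ nright (code_pair v)
      (tnth l (last symbol0 v.2).1 < tnth l (last symbol0 v.1).1) =
      Some (code_pair v', code a, code b, ii, false),
    tnth l b.1 < tnth l a.1 & l' = new_lengths l a b].
Proof.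
rewrite /right_step /nright /= !last_code !letter_code -!map_take !count_code.
set c0 := last symbol0 v.1; set c1 := last symbol0 v.2.
rewrite !(nonce_code v) nth_code underlined_code -!subst_code.
have neq : tnth l c0.1 != tnth l c1.1 -> (c0.1 == c1.1 :> nat) = false.
  by apply: contraNF => /eqP/val_inj ->.
case: ltgtP => lt //.
- rewrite neq; last by rewrite gt_eqF.
  case: ifP => _; first by move=> [<- <-]; exists c0, c1, false.
  case: ifP => // _ [<- <-]; exists c0, c1, true; split => //.
  by rewrite /code_pair /= map_rcons !subst_code; congr (Some (_, _, _, _, _, _)).
- rewrite neq; last by rewrite lt_eqF.
  case: ifP => // _ [<- <-].
  by exists c1, c0, false.
Qed.

Lemma induction_step_code v l v' l' : induction_step v l = Some (v', l') ->
  exists a b ii left, [/\ nstep (code_pair v) (winner_on_top v l) =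
      Some (code_pair v', code a, code b, ii, left),
    tnth l b.1 < tnth l a.1 & l' = new_lengths l a b].
Proof.
rewrite /induction_step /nstep /winner_on_top.
have -> : gap_position (code_pair v).2 = find (fun c : symbol => c.2) v.2.
  by rewrite /gap_position find_map; apply: eq_find => c /=; rewrite code_gap.
set p := find _ _.
case: (p \in [:: 3; 4]%N).
  by move=> /right_step_code [a [b [ii H]]]; exists a, b, ii, false.
case: (p \in [:: 0; 1]%N) => //.
rewrite /left_step; case E : (right_step (mirror v) l) => [[v1 l1]|] //= [<- <-].
have [a [b [ii [H lt ->]]]] := right_step_code E.
exists a, b, ii, true; split => //; move: H; rewrite /code_pair /mirror /= !map_rev.
by move=> ->.
Qed.

End Steps.

Lemma is_word_pair_code v : is_itm_perm v -> is_word_pair (code_pair v).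
Proof.
case/existsP => alpha /andP[p1 p2].
have E : map code (map plain (enum 'I_4)) = iota 0 4.
  rewrite -map_comp -val_enum_ord; apply: eq_map => i.
  by rewrite /= /code /= mul0n addn0.
have := perm_map code p1; have := perm_map code p2.
rewrite /= E /code /= mul0n addn0 mul1n -/(code_pair v).1 => q2 q1.
rewrite /is_word_pair /gap_position.
have h4 : has (fun c => 4 <= c)%N (code_pair v).2.
  by rewrite (perm_has _ q2) /= leq_addl.
have := nth_find 0%N h4; set c := nth _ _ _ => c4.
have : c \in (alpha + 4)%N :: iota 0 4.
  by rewrite -(perm_mem q2) mem_nth // -has_find.
rewrite inE mem_iota ltnNge c4 andbF orbF => /eqP ->.
by rewrite addnK ltn_ord q1 q2.
Qed.

Section Orbit.
Variables (R : realType) (x : base R).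
Hypothesis Xx : X R x.
Hypothesis perm_x : is_itm_perm x.1.

Definition orbit (n : nat) : base R := iter n (@T R) x.

Definition orbit_word (n : nat) : word * word := code_pair (orbit n).1.

Definition orbit_top (n : nat) : bool := winner_on_top (orbit n).1 (orbit n).2.

Definition orbit_move (n : nat) : nmove :=
  odflt (orbit_word n, 0%N, 0%N, false, false) (nstep (orbit_word n) (orbit_top n)).

Definition orbit_ratio (n : nat) : R :=
  if induction_step (orbit n).1 (orbit n).2 is Some z then lnorm z.2 else 1.

Lemma orbit_step n : exists v' l',
  induction_step (orbit n).1 (orbit n).2 = Some (v', l') /\
  orbit n.+1 = (v', [tuple tnth l' a / lnorm l' | a < 4]).
Proof.
have H m : iter m (obind (@proj_step R)) (Some x) = Some (orbit m).
  elim: m => // m IH; have [_ _ /(_ m.+1)] := Xx.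
  by rewrite /= IH /= /orbit /= /T; case: (proj_step _).
have [_ _ /(_ n.+1)] := Xx; rewrite /= H /= /orbit /= -/(orbit n) /T /proj_step.
by case: (induction_step _ _) => [[v' l']|] //= _; exists v', l'.
Qed.

Lemma orbit_simplex n : simplex R (orbit n).2.
Proof.
elim: n => [|n [pos nrm]]; first by have [_] := Xx.
have [v' [l' [E ->]]] := orbit_step n.
have [a [b [ii [left [_ lt lE]]]]] := induction_step_code E.
have pos' : positive_lengths l'.
  move=> i; rewrite lE tnth_mktuple; case: ifP => _; last exact: pos.
  by rewrite subr_gt0.
have n0 : 0 < lnorm l'.
  rewrite /lnorm (bigD1 ord0) //= ltr_pwDl //.
  by apply: sumr_ge0 => i _; apply: ltW.
split=> /=; first by move=> i; rewrite tnth_mktuple divr_gt0.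
rewrite /lnorm; under eq_bigr => i _ do rewrite tnth_mktuple.
by rewrite -mulr_suml divff // gt_eqF.
Qed.

(** Only the winner changes, losing the length of the loser, and the total was 1: hence the
    ratio. *)
Lemma orbit_moveP n : exists a b ii left,
  [/\ nstep (orbit_word n) (orbit_top n) = Some (orbit_move n),
      orbit_move n = (orbit_word n.+1, code a, code b, ii, left),
      tnth (orbit n).2 b.1 < tnth (orbit n).2 a.1 & 
      0 < orbit_ratio n /\ 
      forall i, orbit_ratio n * tnth (orbit n.+1).2 i =
                 tnth (new_lengths (orbit n).2 a b) i /\
      orbit_ratio n = 1 - tnth (orbit n).2 b.1].
Proof.
have [v' [l' [E on]]] := orbit_step n.
have [a [b [ii [left [H lt lE]]]]] := induction_step_code E.
have [pos nrm] := orbit_simplex n.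
have ab : b.1 != a.1 by apply: contraTneq lt => ->; rewrite ltxx.
have nE : lnorm l' = 1 - tnth (orbit n).2 b.1.
  rewrite -nrm /lnorm (bigD1 a.1) //= [in RHS](bigD1 a.1) //= lE tnth_mktuple eqxx.
  rewrite (eq_bigr (fun i => tnth (orbit n).2 i)); first by rewrite addrAC.
  by move=> i ia; rewrite tnth_mktuple (negbTE ia).
have n0 : 0 < lnorm l'.
  rewrite nE subr_gt0 -nrm /lnorm (bigD1 b.1) //= ltrDl (bigD1 a.1) //=; last by rewrite eq_sym.
  by rewrite ltr_pwDl // sumr_ge0 // => i _; apply: ltW.
have rE : orbit_ratio n = lnorm l' by rewrite /orbit_ratio E.
exists a, b, ii, left; split => //.
- by rewrite /orbit_move H.
- by rewrite /orbit_move H /orbit_word on.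
- split; first by rewrite rE.
  by move=> i; rewrite rE nE on /= tnth_mktuple -nE mulrC divfK ?gt_eqF // lE.
Qed.

Lemma orbit_nstep n : nstep (orbit_word n) (orbit_top n) = Some (orbit_move n).
Proof. by have [a [b [ii [left []]]]] := orbit_moveP n. Qed.

Lemma orbit_move_word n : (orbit_move n).1.1.1.1 = orbit_word n.+1.
Proof. by have [a [b [ii [left [_ -> ]]]]] := orbit_moveP n. Qed.

Lemma orbit_is_word_pair n : is_word_pair (orbit_word n).
Proof.
elim: n => [|n IH]; first exact: is_word_pair_code.
by have /and3P[] := move_consistentP IH (orbit_nstep n); rewrite orbit_move_word.
Qed.

Lemma orbit_consistent n : move_consistent (orbit_word n) (orbit_top n) (orbit_move n).
Proof. exact: move_consistentP (orbit_is_word_pair n) (orbit_nstep n). Qed.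

Definition orbit_canon (n : nat) : word * word := canon (orbit_word n).

Lemma orbit_word_next n :
  word_next (orbit_canon n) (orbit_top n) = Some (orbit_canon n.+1, (orbit_move n).1.2).
Proof.
rewrite /word_next /orbit_canon; have /and3P[_ /eqP -> _] := orbit_consistent n.
by rewrite /= orbit_move_word.
Qed.

(* A step of type (i) keeps the doubled letter, which is not the winner, while the
   total length decreases. *)
Lemma gap_length_increases n : ~~ (orbit_move n).1.2 -> forall d : 'I_4,
  gap_letter (orbit_word n) = d ->
  gap_letter (orbit_word n.+1) = d /\ tnth (orbit n).2 d < tnth (orbit n.+1).2 d.
Proof.
move=> nii d gd; have /and3P[_ _ ] := orbit_consistent n.
rewrite nii implyTb orbit_move_word => /andP[/eqP -> na]; split=> //.
have [a [b [ii [left [_ mE lt [r0 rE]]]]]] := orbit_moveP n.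
have [pos nrm] := orbit_simplex n.
have [] := rE d; rewrite tnth_mktuple.
have -> : (d == a.1) = false.
  by apply: contraNF na => /eqP E; rewrite mE /= letter_code gd E.
have [pos' _] := orbit_simplex n.+1.
by move=> <- rb; rewrite gtr_pMl // rb gtrBl.
Qed.

(** Undoes the normalizations, so that all levels live on the original interval. *)
Definition orbit_scale (n : nat) : R := \prod_(i < n) orbit_ratio i.

(** The value 1 beyond the alphabet provides the positivity at every index that [move_refines] asks
    for. *)
Definition orbit_lengths (n i : nat) : R :=
  if (i < 4)%N then orbit_scale n * tnth (orbit n).2 (inord i) else 1.

Lemma orbit_scale_gt0 n : 0 < orbit_scale n.
Proof. by apply: prodr_gt0 => i _; have [a [b [ii [left [_ _ _ []]]]]] := orbit_moveP i. Qed.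

Lemma orbit_lengths_gt0 n i : 0 < orbit_lengths n i.
Proof.
rewrite /orbit_lengths; case: ifP => // _; have [pos _] := orbit_simplex n.
by rewrite mulr_gt0 // orbit_scale_gt0.
Qed.

Lemma orbit_lengthsE n i : orbit_lengths n i = orbit_lengths n.+1 i +
  (if i == letter (orbit_move n).1.1.1.2
   then orbit_lengths n.+1 (letter (orbit_move n).1.1.2) else 0).
Proof.
have [a [b [ii [left [_ -> lt [_ rE]]]]]] := orbit_moveP n; rewrite /= !letter_code.
have ab : b.1 != a.1 by apply: contraTneq lt => ->; rewrite ltxx.
have sE (c : 'I_4) : orbit_lengths n.+1 c =
    orbit_scale n * tnth (new_lengths (orbit n).2 a b) c.
  have [<- _] := rE c.
  by rewrite /orbit_lengths ltn_ord inord_val /orbit_scale big_ord_recr /= mulrA.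
case: (ltnP i 4) => hi; last first.
  have i4 : (i < 4)%N = false by rewrite ltnNge hi.
  rewrite /orbit_lengths i4 gtn_eqF ?addr0 //.
  exact: leq_trans (ltn_ord a.1) hi.
have -> : i = Ordinal hi :> nat by [].
move: (Ordinal hi) => c {i hi}.
rewrite !sE !tnth_mktuple (negbTE ab) /orbit_lengths ltn_ord inord_val.
case: (eqVneq c a.1) => [->|ca]; first by rewrite eqxx -mulrDr subrK.
by rewrite (_ : (c == a.1 :> nat) = false) ?addr0 //; apply: negbTE.
Qed.

Fixpoint orbit_level (n : nat) : R * (nat -> nat) :=
  if n is n'.+1 then
    ((orbit_level n').1 + wsum (orbit_lengths n'.+1) (offset_letters (orbit_move n')),
     fun k => (\sum_(j <- move_visits (orbit_word n') (orbit_move n') k)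
                 (orbit_level n').2 j)%N)
  else (0, fun=> 1%N).

Definition orbit_tower (n : nat) : level R :=
  word_level (orbit_word n) (orbit_lengths n) (orbit_level n).1 (orbit_level n).2.

Definition orbit_visits (n k : nat) : seq nat :=
  move_visits (orbit_word n) (orbit_move n) k.

Lemma orbit_refines n : move_ok (orbit_word n) (orbit_move n) ->
  refines (orbit_tower n) (orbit_tower n.+1) (orbit_visits n).
Proof.
move=> ok; have := move_refines (orbit_level n).1 (orbit_level n).2
  (orbit_lengths_gt0 n.+1) (orbit_lengthsE n) ok.
by rewrite orbit_move_word.
Qed.

Hypothesis often_ii : forall n, exists2 m, (n <= m)%N & (orbit_move m).1.2.
Hypothesis recurrent : forall N n, exists2 m, (n <= m)%N &
  forall i, (i < N)%N -> (orbit (m + i)).1 = (orbit i).1 /\ orbit_top (m + i) = orbit_top i.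

Let ii n : bool := (orbit_move n).1.2.

Lemma count_ii K : exists n, (K <= \sum_(i < n) ii i)%N.
Proof.
elim: K => [|K [n IH]]; first by exists 0%N.
have [m nm mi] := often_ii n; exists m.+1.
rewrite big_ord_recr /= /ii mi addn1 ltnS (leq_trans IH) //.
rewrite -(subnKC nm) big_split_ord /= leq_addr //.
Qed.

(** Three steps of type (ii) lead into the core. The initial words recur after that, so the orbit
    has been in the core from time 0. *)
Lemma orbit_canon_core n : orbit_canon n \in core.
Proof.
have w0 k : orbit_canon k \in canonical_words by apply: canonical_wordsP (orbit_is_word_pair k).
have [M hM] := count_ii 3.
have [m Mm rec] := recurrent 1 M.
have cm : (3 <= \sum_(i < m) ii i)%N.
  by rewrite (leq_trans hM) // -(subnKC Mm) big_split_ord leq_addr.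
have inm := core_reached orbit_word_next w0 cm.
have in0 : orbit_canon 0 \in core.
  move: inm; rewrite /orbit_canon /orbit_word.
  by have [] := rec 0%N isT; rewrite addn0 => ->.
by have := core_kept orbit_word_next n in0; rewrite add0n.
Qed.

Lemma orbit_move_ok n : move_ok (orbit_word n) (orbit_move n).
Proof. by have [] := core_moveP (orbit_is_word_pair n) (orbit_canon_core n) (orbit_nstep n). Qed.

Let visiting (j n : nat) : nat * seq nat :=
  (index (orbit_canon n) core, [seq k <- iota 0 5 | j \in itinerary orbit_visits 0 n k]).

(** A new itinerary concatenates itineraries of old pieces, so it meets [j] exactly when one of
    these does. *)
Let visiting_run j n : visiting_next (move_table core) (visiting j n) (orbit_top n) =
  Some (visiting j n.+1, ii n).
Proof.
have [_ [m' E vis]] :=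
  core_moveP (orbit_is_word_pair n) (orbit_canon_core n) (orbit_nstep n).
have W := orbit_word_next n; rewrite /word_next E /canon_move in W.
have E1 : canon m'.1.1.1.1 = orbit_canon n.+1.
  exact: (congr1 (fun o => if o is Some p then p.1 else orbit_canon n) W).
have E2 : m'.1.2 = ii n.
  exact: (congr1 (fun o => if o is Some p then p.2 else ii n) W).
rewrite (visiting_nextE _ (orbit_canon_core n) E) E1 E2 /visiting.
congr (Some (_, _, _)); apply: eq_in_filter => k; rewrite mem_iota => hk; rewrite -vis //.
rewrite -[move_visits _ _ _]/(orbit_visits n k).
rewrite itineraryS add0n.
have lt5 : all (fun i => i < 5)%N (orbit_visits n k).
  by have [_ []] := height_refines (orbit_refines (orbit_move_ok n)) hk.
have memE i : mem [seq k <- iota 0 5 | j \in itinerary orbit_visits 0 n k] i =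
    (i < 5)%N && (j \in itinerary orbit_visits 0 n i).
  by rewrite -[mem _ _]/(i \in [seq k <- iota 0 5 | _]) mem_filter mem_iota andbC.
apply/hasP/flattenP => [[i iv]|[s /mapP [i iv ->]] ji].
  by rewrite memE => /andP[_ ji]; exists (itinerary orbit_visits 0 n i); rewrite ?map_f.
by exists i => //; rewrite memE ji andbT; apply: (allP lt5).
Qed.

(** The block at time 0 with eleven steps of type (ii) is positive; its later copies have the same
    [N] and [B]. *)
Lemma orbit_positive_blocks : exists N B, forall n0,
  exists2 n, (n0 <= n)%N & positive_block orbit_visits n N B.
Proof.
have [N hN] := count_ii 11.
pose B := (\max_(k < 5) size (itinerary orbit_visits 0 N k))%N.
have block0 : positive_block orbit_visits 0 N B.
  move=> k hk; split=> [j hj|]; last exact: (leq_bigmax (Ordinal hk)).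
  have x0 : visiting j 0 = (index (orbit_canon 0) core, [:: j]).
    rewrite /visiting; congr (_, _).
    by move: hj; case: j => [|[|[|[|[|]]]]].
  have full : [seq i <- iota 0 5 | j \in itinerary orbit_visits 0 N i] = iota 0 5.
    exact: visiting_full (visiting_run j) (orbit_canon_core 0) hj x0 hN.
  have : k \in iota 0 5 by rewrite mem_iota.
  by rewrite -full mem_filter => /andP[].
(* Itineraries depend on the words and on the bits only, not on the lengths. *)
have same n : (forall i, (i < N)%N -> (orbit (n + i)).1 = (orbit i).1 /\
      orbit_top (n + i) = orbit_top i) ->
    forall M, (M <= N)%N -> itinerary orbit_visits n M =1 itinerary orbit_visits 0 M.
  move=> H; elim=> [_ k|M IH hM k]; first by []; rewrite !itineraryS.
  have [w t] := H M hM.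
  have -> : orbit_visits (n + M) k = orbit_visits (0 + M) k.
    by rewrite add0n /orbit_visits /orbit_move /orbit_word w t.
  by congr flatten; apply: eq_map; apply: IH; apply: ltnW.
exists N, B => n0; have [n n0n H] := recurrent N n0.
exists n => // k hk; rewrite (same n H N (leqnn N) k); exact: block0.
Qed.

Let L := word_length x.2 x.1.1.

Lemma orbit_tower0_cut k : cut (orbit_tower 0) k = word_length x.2 (take k x.1.1).
Proof.
rewrite /= add0r /wsum /word_length /orbit_word /code_pair /= -map_take big_map.
rewrite big_map; apply: eq_bigr => c _; rewrite letter_code /orbit_lengths ltn_ord inord_val.
by rewrite /orbit_scale big_ord0 mul1r.
Qed.

Lemma orbit_tower0_shift k : shift (orbit_tower 0) k =
  word_length x.2 (take (index (nth symbol0 x.1.1 k) x.1.2) x.1.2) -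
  word_length x.2 (take k x.1.1).
Proof.
rewrite -orbit_tower0_cut /= add0r; congr (_ - _).
rewrite /wsum /word_length /orbit_word /code_pair /= nth_code (index_map code_inj).
rewrite -map_take !big_map; apply: eq_bigr => c _.
by rewrite letter_code /orbit_lengths ltn_ord inord_val /orbit_scale big_ord0 mul1r.
Qed.

Lemma size_words : size x.1.1 = 5%N.
Proof.
case/existsP: perm_x => alpha /andP[/perm_size -> _].
by rewrite /= size_map size_enum_ord.
Qed.

Lemma cut0 : cut (orbit_tower 0) 0 = 0.
Proof. by rewrite orbit_tower0_cut take0 /word_length big_nil. Qed.

Lemma cut5 : cut (orbit_tower 0) 5 = L.
Proof. by rewrite orbit_tower0_cut -size_words take_size. Qed.

Lemma orbit_cut_increasing k : (k < 5)%N -> cut (orbit_tower 0) k < cut (orbit_tower 0) k.+1.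
Proof.
move=> hk; rewrite !orbit_tower0_cut (take_nth symbol0) ?size_words //.
rewrite /word_length -cats1 big_cat big_seq1 /= ltrDl.
by have [pos _] := orbit_simplex 0; apply: pos.
Qed.

Lemma itm_map_piece k y : (k < 5)%N -> in_piece (orbit_tower 0) k y ->
  itm_map x.1 x.2 y = y + shift (orbit_tower 0) k.
Proof.
move=> hk yk; rewrite /itm_map orbit_tower0_shift; congr (_ + _).
have hk' : (k < size x.1.1)%N by rewrite size_words.
rewrite (bigD1 (Ordinal hk')) //= -!orbit_tower0_cut.
have -> : cut (orbit_tower 0) k <= y < cut (orbit_tower 0) k.+1 = true by exact: yk.
rewrite big1 ?addr0 ?orbit_tower0_cut // => i ik.
rewrite -!orbit_tower0_cut; case: ifP => // yi; exfalso.
have hi : (i < 5)%N by rewrite -size_words.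
have /eqP := ik; apply; apply/val_inj.
exact: (piece_unique orbit_cut_increasing hi hk yi yk).
Qed.

(* The word of level 0 recurs, so the image of its map is controlled by the
   check of the previous step. *)
Lemma orbit_tower0 : tower (itm_map x.1 x.2) (fun y => 0 <= y < L) (orbit_tower 0).
Proof.
have baseE y : in_base (orbit_tower 0) y = (0 <= y < L) by rewrite /in_base cut0 cut5.
split.
- by move=> k hk; split=> //; apply: orbit_cut_increasing.
- move=> k y hk yk; rewrite /= (itm_map_piece hk yk); split=> //; last by case.
  have [[|m] m0 rec] := recurrent 1 1; first by [].
  have [w _] := rec 0%N isT; rewrite addn0 in w.
  have E : orbit_word m.+1 = orbit_word 0 by rewrite /orbit_word w.
  have := orbit_move_ok m; rewrite /move_ok orbit_move_word E.
  move=> /and5P[_ _ _ _ /and3P[/allP /(_ k) + _ _]]; rewrite mem_iota => /(_ hk).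
  have lam0 i : 0 <= orbit_lengths 0 i by rewrite ltW // orbit_lengths_gt0.
  move=> /(wsum_le lam0); rewrite wsum_cat.
  have s5 : size (orbit_word 0).1 = 5%N by rewrite /orbit_word size_map size_words.
  have := wsum_ge0 (map letter (take (index (nth 0%N (orbit_word 0).1 k)
    (orbit_word 0).2) (orbit_word 0).2)) lam0.
  move: yk; rewrite /in_piece /in_base cut0 /=.
  have -> : map letter (take k.+1 (orbit_word 0).1) =
      map letter (take k (orbit_word 0).1) ++ [:: letter (nth 0%N (orbit_word 0).1 k)].
    by rewrite (take_nth 0%N) ?s5 // map_rcons cats1.
  have take5 : take 5 (orbit_word 0).1 = (orbit_word 0).1 by rewrite -s5 take_size.
  rewrite wsum_cat take5 => /andP[h1 h2] h3 h4.
  by apply/andP; split; lra.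
- move=> k y z i hk yk zk; case: i => [|[|]] //= _; first by rewrite !subrr.
  by rewrite !(itm_map_piece hk) //; lra.
- by exists 0%N => y y0; exists 0%N => //; rewrite baseE.
Qed.

Lemma orbit_uniquely_ergodic : uniquely_ergodic x.1 x.2.
Proof.
have [N [B blocks]] := orbit_positive_blocks.
have base0 y : (0 <= y < L) = in_base (orbit_tower 0) y by rewrite /in_base cut0 cut5.
have L0 : 0 < L.
  rewrite -cut5 -cut0.
  have inc := orbit_cut_increasing.
  apply: lt_trans (inc 4 _) => //; apply: lt_trans (inc 3 _) => //.
  by apply: lt_trans (inc 2 _) => //; apply: lt_trans (inc 1%N _) => //; apply: inc.
have stable y : 0 <= y < L -> 0 <= itm_map x.1 x.2 y < L.
  rewrite base0 => /base_piece [k hk yk]; rewrite base0 (itm_map_piece hk yk).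
  by have [_ /(_ _ _ hk yk) [_ ->]] := orbit_tower0.
have mF : measurable_fun setT (itm_map x.1 x.2).
  apply: measurable_funD => //; apply: measurable_sum => i.
  apply: measurable_fun_ifT => //; apply: measurable_and => //.
    exact: measurable_fun_ler.
  exact: measurable_fun_ltr.
have [P [inv uniq]] := towers_uniquely_ergodic mF stable L0 orbit_tower0
  (fun n => orbit_refines (orbit_move_ok n)) blocks base0 itm_map_piece.
by exists P.
Qed.

End Orbit.

Lemma ae_countable (d : measure_display) (Y : measurableType d) (R : realType)
    (mu : measure Y R) (K : countType) (P : K -> Y -> Prop) :
  (forall k, {ae mu, forall y, P k y}) -> {ae mu, forall y, forall k, P k y}.
Proof.
move=> aeP; have : {ae mu, forall y, forall n : nat,
    if (unpickle n : option K) is Some k then P k y else True}.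
  apply: ae_foralln => n; case: (unpickle n) => [k|]; first exact: aeP.
  by apply: aeW.
by apply: filterS => y H k; have := H (pickle k); rewrite pickleK.
Qed.

Section AlmostEverywhere.
Variables (R : realType) (mu : probability (base R) R).
Hypothesis inv : forall A, measurable A -> mu (@T R @^-1` A) = mu A.

Let recurs (A : set (base R)) : measurable A -> {ae mu, forall x, forall m,
  A (iter m (@T R) x) -> exists2 n, (m < n)%N & A (iter n (@T R) x)}.
Proof. exact: poincare_recurrence (@measurable_T R) inv A. Qed.

(** If the length increased strictly from time m on, a rational q between its first two values would
    give a set {length < q} visited at time m and never again; there are countably many q. *)
Lemma ae_not_increasing : {ae mu, forall x, forall (d : 'I_4) m,
  exists2 n, (m <= n)%N & tnth (orbit x n.+1).2 d <= tnth (orbit x n).2 d}.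
Proof.
apply: ae_countable => d.
have : {ae mu, forall x, forall (q : rat) m, tnth (orbit x m).2 d < ratr q ->
    exists2 n, (m < n)%N & tnth (orbit x n).2 d < ratr q}.
  apply: ae_countable => q.
  apply: (recurs (A := [set y : base R | tnth y.2 d < ratr q])).
  apply: measurable_sections => v.
  have mlt : measurable_fun setT (fun l : 4.-tuple R => tnth l d < ratr q).
    by apply: measurable_fun_ltr => //; apply: measurable_tnth_fun.
  by have := mlt measurableT [set true] I; rewrite setTI.
apply: filterS => x H m; apply: contrapT => no.
have up n : (m <= n)%N -> tnth (orbit x n).2 d < tnth (orbit x n.+1).2 d.
  by move=> mn; rewrite ltNge; apply/negP => le; apply: no; exists n.
have [q] := rat_in_itvoo (up m (leqnn m)); rewrite in_itv /= => /andP[q1 q2].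
have [n mn] := H q m q1; apply/negP; rewrite -leNgt ltW // (lt_le_trans q2) //.
rewrite -(subnKC mn); elim: (n - m.+1)%N => [|k IH]; first by rewrite addn0.
rewrite addnS (le_trans IH) // ltW // up //; lia.
Qed.

Definition cylinder (s : seq (seq symbol * seq symbol * bool)) : set (base R) :=
  [set y | forall i, (i < size s)%N ->
     ((orbit y i).1, orbit_top y i) = nth (([::], [::]), false) s i].

Lemma measurable_cylinder s : measurable (cylinder s).
Proof.
have -> : cylinder s = \bigcap_(i in `I_(size s)) (iter i (@T R) @^-1`
    [set y | (y.1, winner_on_top y.1 y.2) = nth (([::], [::]), false) s i]).
  by rewrite predeqE => y; split => H i hi; apply: H.
apply: bigcap_measurableType => i _.
apply: measurable_preimage_iter; first exact: measurable_T.
case: (nth _ s i) => w b; apply: measurable_sections => v /=.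
have [->|vw] := eqVneq v w.
  have -> : [set l : 4.-tuple R | (w, winner_on_top w l) = (w, b)] =
      (fun l : 4.-tuple R => winner_on_top w l) @^-1` [set b].
    by rewrite predeqE => l /=; split => [[]|->].
  by rewrite -[X in measurable X]setTI; apply: measurable_winner_on_top.
have -> : [set l : 4.-tuple R | (v, winner_on_top v l) = (w, b)] = set0; last exact: measurable0.
by rewrite predeqE => l; split => // -[E _]; rewrite E eqxx in vw.
Qed.

(** The cylinder of x depends on x, but recurrence holds almost surely for all of the countably many
    cylinders at once. *)
Lemma ae_recurrent : {ae mu, forall x, forall N n, exists2 m, (n <= m)%N &
  forall i, (i < N)%N -> (orbit x (m + i)).1 = (orbit x i).1 /\
                         orbit_top x (m + i) = orbit_top x i}.
Proof.
have : {ae mu, forall x, forall s m, cylinder s (iter m (@T R) x) ->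
    exists2 n, (m < n)%N & cylinder s (iter n (@T R) x)}.
  by apply: ae_countable => s; apply: recurs; apply: measurable_cylinder.
apply: filterS => x H N n.
pose s := [seq ((orbit x i).1, orbit_top x i) | i <- iota 0 N].
have cs m : cylinder s (iter m (@T R) x) <-> forall i, (i < N)%N ->
    (orbit x (m + i)).1 = (orbit x i).1 /\ orbit_top x (m + i) = orbit_top x i.
  rewrite /cylinder /= size_map size_iota.
  have E i : (i < N)%N -> nth (([::], [::]), false) s i = ((orbit x i).1, orbit_top x i).
    by move=> hi; rewrite (nth_map 0%N) ?size_iota // nth_iota.
  have E' i : orbit (iter m (@T R) x) i = orbit x (m + i).
    by rewrite /orbit addnC iterD.
  have E2 i : orbit_top (iter m (@T R) x) i = orbit_top x (m + i).
    by rewrite /orbit_top E'.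
  split=> K i hi; first by have := K i hi; rewrite E // E' E2 => -[-> ->].
  by have [k1 k2] := K i hi; rewrite E // E' E2 k1 k2.
elim: n => [|n [m nm /cs c]]; first by exists 0%N.
by have [m' mm' c'] := H s m c; exists m'; [exact: leq_ltn_trans mm'|exact/cs].
Qed.

End AlmostEverywhere.

Theorem theorem2 (R : realType) (mu : probability (base R) R)
    (nu : probability (base R * R)%type R) :
  T_invariant mu -> induces mu nu -> maximal_entropy nu ->
  {ae mu, forall x : base R,
    X R x -> splitting_perm R x.1 -> uniquely_ergodic x.1 x.2}.
Proof.
move=> [_ inv] _ _.
have := ae_not_increasing inv; apply: filterS2 (ae_recurrent inv).
move=> x rec noinc Xx [M [l [_ [perm _ _ _]]]].
apply: orbit_uniquely_ergodic => // n; apply: contrapT => no.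
have nii m : (n <= m)%N -> ~~ (orbit_move x m).1.2.
  by move=> nm; apply/negP => h; apply: no; exists m.
have hd : (gap_letter (orbit_word x n) < 4)%N.
  by rewrite /gap_letter nth_code letter_code.
have gd m : (n <= m)%N -> gap_letter (orbit_word x m) = Ordinal hd.
  move=> /subnKC <-; elim: (m - n)%N => [|k IH]; first by rewrite addn0.
  rewrite addnS; have [] := gap_length_increases Xx perm (nii (n + k)%N _) IH => //.
  exact: leq_addr.
have [m nm] := noinc (Ordinal hd) n.
have [_] := gap_length_increases Xx perm (nii m nm) (gd m nm).
by rewrite ltNge => /negP.
Qed.
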